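(* Let $c>0$, let $d=d(c)$ and $m(\cdot)$ be the edge and the Stieltjes transform of the distribution $F_c$ described in the context, and let $\lambda>0$ and $a\in\mathbb R$. For real $\ell$ with $|\ell|>d$ define $$g(\ell)=\Big(\frac12+\frac1{1-c^2m^2(\ell)+\sqrt{1-c^2m^2(\ell)}}\Big)^{-1}\Big[\frac{c\,m(\ell)}{1-c^2m^2(\ell)+\sqrt{1-c^2m^2(\ell)}}\Big(1+\frac1\lambda\Big)+\frac{\ell}{\lambda}\Big],$$ and let $g(d)=\lim_{\ell\downarrow d}g(\ell)$ and $g(-d)=\lim_{\ell\uparrow -d}g(\ell)=-g(d)$. Then $g$ is increasing on $(d,\infty)$ and on $(-\infty,-d)$, and the solutions $\ell$ of the equation $g(\ell)=a$ are as follows. Case I, $g(d)\ge 0$: (i) if $a>g(d)$, there is one solution in $(d,\infty)$ and no solution in $(-\infty,-d)$; (ii) if $-g(d)\le a\le g(d)$, there is no solution in $(d,\infty)\cup(-\infty,-d)$; (iii) if $a<-g(d)$, there is one solution in $(-\infty,-d)$ and no solution in $(d,\infty)$. Case II, $g(d)<0$: (i) if $a\ge -g(d)$, there is one solution in $(d,\infty)$ and no solution in $(-\infty,-d)$; (ii) if $g(d)<a<-g(d)$, there is one solution in $(d,\infty)$ and one solution in $(-\infty,-d)$; (iii) if $a\le g(d)$, there is one solution in $(-\infty,-d)$ and no solution in $(d,\infty)$.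
   Context: $F_c$ is the probability distribution on $\mathbb R$ with density $$\phi_c(x)=\frac1{2c\pi}\sqrt{\frac{y_0^2}{1+y_0}-\Big(\frac{1-c}{|x|}+\frac1{\sqrt{1+y_0}}\Big)^2},\qquad |x|\le d(c),$$ (together with a point mass $1-1/c$ at the origin if $c>1$), where $y_0=y_0(x)$ is the largest real root of $y^3-\frac{(1-c)^2-x^2}{x^2}y^2-\frac4{x^2}y-\frac4{x^2}=0$, and $d(c)=\frac{(1-c)\sqrt{1+y_1}}{y_1-1}$ if $c\ne1$, $d(1)=2$, where $y_1$ is the only real root of $((1-c)^2-1)y^3+y^2+y-1=0$ such that $y_1>1$ if $c<1$ and $y_1\in(0,1)$ if $c>1$. It is the almost sure limiting spectral distribution (for any fixed integer $\tau\ge1$) of $M_n(\tau)=\frac1{2T}\sum_{j=1}^T(e_je_{j+\tau}^*+e_{j+\tau}e_j^* )$ as $n,T\to\infty$ with $n/T\to c$, where $e_j$ are $n$-vectors with i.i.d. mean-$0$, variance-$1$ entries. Its Stieltjes transform is $m(\ell)=\int\frac{1}{x-\ell}\,dF_c(x)$, real-valued for real $\ell$ with $|\ell|>d(c)$, where $c^2m^2(\ell)<1$; square roots are nonnegative. *)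

(* Defs.v *)
From HB Require Import structures.
From mathcomp Require Import all_boot all_order all_algebra.
From mathcomp Require Import all_classical all_reals all_analysis.
From mathcomp Require Import measurable_realfun ring lra.

Set Implicit Arguments.
Unset Strict Implicit.
Unset Printing Implicit Defensive.

Import Order.TTheory GRing.Theory Num.Theory.
Import numFieldNormedType.Exports.

Local Open Scope classical_set_scope.
Local Open Scope ring_scope.

Section density.
Context {R : realType}.
Implicit Types c x y : R.

Definition y0_root c x y : Prop :=
  y ^+ 3 - ((1 - c) ^+ 2 - x ^+ 2) / x ^+ 2 * y ^+ 2
    - 4 / x ^+ 2 * y - 4 / x ^+ 2 = 0.

(* [xget 0 P] is some element of [P] (and 0 if there is none); [y0_spec] below
   shows that the largest real root exists for every [x != 0]. *)
Definition y0 c x : R :=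
  xget 0 [set y | y0_root c x y /\ forall z, y0_root c x z -> z <= y].

Definition y1 c : R :=
  xget 0 [set y | ((1 - c) ^+ 2 - 1) * y ^+ 3 + y ^+ 2 + y - 1 = 0 /\
                  (if c < 1 then 1 < y else 0 < y < 1)].

Definition d c : R :=
  if c == 1 then 2 else (1 - c) * Num.sqrt (1 + y1 c) / (y1 c - 1).

(* The value at the single point x = 0 (where the formula divides by 0) is
   irrelevant, the density being used only under the Lebesgue measure. *)
Definition phi c x : R :=
  if `|x| <= d c then
    (2 * c * pi)^-1 *
    Num.sqrt (y0 c x ^+ 2 / (1 + y0 c x) -
              ((1 - c) / `|x| + (Num.sqrt (1 + y0 c x))^-1) ^+ 2)
  else 0.

Lemma y0_rootE c x y : x != 0 ->
  y0_root c x y <->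
  x ^+ 2 * (y ^+ 2 * (1 + y)) = (1 - c) ^+ 2 * y ^+ 2 + 4 * (1 + y).
Proof.
move=> x0; rewrite /y0_root.
have -> : y ^+ 3 - ((1 - c) ^+ 2 - x ^+ 2) / x ^+ 2 * y ^+ 2
    - 4 / x ^+ 2 * y - 4 / x ^+ 2 =
  (x ^+ 2 * (y ^+ 2 * (1 + y)) - ((1 - c) ^+ 2 * y ^+ 2 + 4 * (1 + y)))
    / x ^+ 2 by field.
split=> [/eqP|->]; last by rewrite subrr mul0r.
rewrite mulf_eq0 invr_eq0 expf_eq0 (negbTE x0) orbF subr_eq0.
by move=> /eqP.
Qed.

Lemma y0_root_anti c x x' y y' : x != 0 -> x' != 0 -> 0 < y -> y < y' ->
  y0_root c x y -> y0_root c x' y' -> x' ^+ 2 < x ^+ 2.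
Proof.
move=> x0 x'0 y_gt0 yy'.
have y'_gt0 : 0 < y' by exact: lt_trans yy'.
move=> /(y0_rootE _ _ x0) e /(y0_rootE _ _ x'0) e'.
have E (t s : R) : 0 < s ->
    t ^+ 2 * (s ^+ 2 * (1 + s)) = (1 - c) ^+ 2 * s ^+ 2 + 4 * (1 + s) ->
    t ^+ 2 = (1 - c) ^+ 2 / (1 + s) + 4 / s ^+ 2.
  move=> s0 h; have s1 : 1 + s != 0 by rewrite gt_eqF// addr_gt0.
  have s2 : s != 0 by rewrite gt_eqF.
  have : t ^+ 2 = (t ^+ 2 * (s ^+ 2 * (1 + s))) / (s ^+ 2 * (1 + s)).
    by field; rewrite s1 s2.
  by rewrite h => ->; field; rewrite s1 s2.
rewrite (E _ _ y_gt0 e) (E _ _ y'_gt0 e'); apply: ler_ltD.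
  apply: ler_wpM2l; first exact: sqr_ge0.
  by rewrite lef_pV2 ?posrE ?addr_gt0// lerD2l ltW.
rewrite ltr_pM2l// ltf_pV2 ?posrE ?exprn_gt0//.
by rewrite ltr_pXn2r// nnegrE ltW.
Qed.

Lemma y0_root_ex c x : x != 0 -> exists2 y, 0 < y & y0_root c x y.
Proof.
move=> x0; pose b := 4 / x ^+ 2; pose a := ((1 - c) ^+ 2 - x ^+ 2) / x ^+ 2.
have b0 : 0 < b by rewrite divr_gt0// exprn_even_gt0.
pose p : {poly R} := 'X^3 - a%:P * 'X^2 - b%:P * 'X - b%:P.
have pE y : p.[y] = y ^+ 3 - a * y ^+ 2 - b * y - b.
  by rewrite /p !hornerE.
pose M := 1 + `|a| + 2 * b.
have M0 : 0 <= M by rewrite /M !addr_ge0// mulr_ge0// ltW.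
have [|y /andP[y_ge0 yM] /rootP py] := @poly_ivt _ p 0 M M0.
  rewrite !pE; apply/andP; split.
    by rewrite !expr0n/= !mulr0 !subr0 add0r oppr_le0 ltW.
  have -> : M ^+ 3 - a * M ^+ 2 - b * M - b =
      M ^+ 2 * (M - a - 2 * b - 1) + (M ^+ 2 + b * M * (M - 1)
      + b * (M ^+ 2 - 1)) by ring.
  have M1 : 1 <= M by rewrite /M -addrA lerDl addr_ge0// mulr_ge0// ltW.
  have M21 : 1 <= M ^+ 2 by rewrite exprn_ege1.
  apply: addr_ge0.
    apply: mulr_ge0; first exact: sqr_ge0.
    by have := ler_norm a; rewrite /M; lra.
  rewrite addr_ge0//; first rewrite addr_ge0 ?sqr_ge0//.
    by rewrite mulr_ge0 ?subr_ge0// mulr_ge0// ltW.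
  by rewrite mulr_ge0 ?subr_ge0// ltW.
exists y; last by have := pE y; rewrite py /y0_root -/a -/b => <-.
rewrite lt_neqAle y_ge0 andbT; apply/eqP => y00.
move: py; rewrite -y00 pE !expr0n/= !mulr0 !subr0 add0r => /eqP.
by rewrite oppr_eq0 gt_eqF.
Qed.

Lemma y0_spec c x : x != 0 ->
  [/\ 0 < y0 c x, y0_root c x (y0 c x) &
      forall z, y0_root c x z -> z <= y0 c x].
Proof.
move=> x0; have [y y_gt0 ry] := y0_root_ex c x0.
have : exists y, [set y | y0_root c x y /\
    forall z, y0_root c x z -> z <= y] y.
  exists y; split => // z rz; rewrite leNgt; apply/negP => yz.
  by have := y0_root_anti x0 x0 y_gt0 yz ry rz; rewrite ltxx.
move=> /(xgetPex 0); rewrite -/(y0 c x) => -[r1 r2]; split => //.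
exact: lt_le_trans (r2 _ ry).
Qed.

Lemma phi_normr c x : phi c `|x| = phi c x.
Proof.
have h : y0 c `|x| = y0 c x by rewrite /y0 /y0_root real_normK ?num_real.
by rewrite /phi h normr_id.
Qed.

Lemma phi_ge0 c x : 0 < c -> 0 <= phi c x.
Proof.
move=> c0; rewrite /phi; case: ifPn => // _.
by rewrite mulr_ge0 ?sqrtr_ge0// invr_ge0 !mulr_ge0// ?pi_ge0// ltW.
Qed.

Lemma measurable_phi c : measurable_fun [set: R] (phi c).
Proof.
pose D : set R := `]0, +oo[%classic.
have mD : measurable D by exact: measurable_itv.
have Dgt0 x : D x -> 0 < x by rewrite /D/= in_itv/= andbT.
have ninc (f : R -> R) :
    (forall x y, 0 < x -> x <= y -> f y <= f x) -> measurable_fun D f.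
  move=> fD; apply: (measurability (@RGenCInfty.G R)) => [|/= _ [_] [r] -> <-].
    exact: RGenCInfty.measurableE.
  apply: is_interval_measurable => x y [/= Dx fx] [Dy fy] z /andP[xz zy].
  have z0 : 0 < z by apply: lt_le_trans xz; exact: Dgt0.
  split; first by rewrite /D/= in_itv/= andbT.
  by move: fy; rewrite /= !in_itv/= !andbT => /le_trans; apply; exact: fD.
have my0 : measurable_fun D (y0 c).
  apply: ninc => x y x_gt0 xy.
  have y_gt0 : 0 < y by exact: lt_le_trans xy.
  have [px rx _] := y0_spec c (lt0r_neq0 x_gt0).
  have [py ry _] := y0_spec c (lt0r_neq0 y_gt0).
  rewrite leNgt; apply/negP => h.
  have := y0_root_anti (lt0r_neq0 x_gt0) (lt0r_neq0 y_gt0) px h rx ry.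
  by rewrite ltNge lerXn2r// nnegrE ltW.
have mV : measurable_fun D (fun x : R => x^-1).
  by apply: ninc => x y x0 xy; rewrite lef_pV2// posrE (lt_le_trans x0 xy).
have m1y : measurable_fun D (fun x => 1 + y0 c x).
  exact: measurable_funD.
have msqrt : measurable_fun [set: R] (@Num.sqrt R).
  by apply: continuous_measurable_fun; exact: sqrt_continuous.
have y0_gt0 x : D x -> 0 < 1 + y0 c x.
  by move=> /Dgt0 x0; rewrite addr_gt0//; have [] := y0_spec c (lt0r_neq0 x0).
have mVcomp (f : R -> R) : (forall x, D x -> 0 < f x) ->
    measurable_fun D f -> measurable_fun D (fun x => (f x)^-1).
  move=> f0 mf; apply: (measurable_comp mD _ mV mf).
  by move=> _ [x Dx <-]; rewrite /D/= in_itv/= andbT f0.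
pose E : set R := `[0, +oo[%classic.
have mE : measurable_fun E (phi c).
  have -> : E = [set 0] `|` D.
    by apply/seteqP; split=> x; rewrite /E /D/= !in_itv/= !andbT le_eqVlt;
      [move=> /predU1P[->|]; [left|right]|
       move=> [->|->]; rewrite ?eqxx ?orbT].
  apply/measurable_funU => //; split; first exact: measurable_fun_set1.
  apply: measurable_fun_if => //.
    exact: measurable_fun_ler.
  apply: (@measurable_funS _ _ _ _ D) => //; apply: measurable_funM => //.
  apply: (measurableT_comp msqrt); apply: measurable_funB.
    apply: measurable_funM; first exact: measurable_funX.
    exact: mVcomp.
  apply/measurable_funX/measurable_funD.
    apply: measurable_funM => //.
    apply: eq_measurable_fun mV => x; rewrite inE => /Dgt0 x0.
    by rewrite gtr0_norm.
  apply: mVcomp; last exact: measurableT_comp.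
  by move=> x /y0_gt0; rewrite sqrtr_gt0.
rewrite (_ : phi c = phi c \o (@Num.norm R R)); last first.
  by apply/funext => x /=; rewrite phi_normr.
apply: (@measurable_comp _ _ _ _ _ _ E) => //.
- exact: measurable_itv.
- by move=> _ [x _ <-]; rewrite /E/= in_itv/= andbT.
Qed.

End density.

Section distribution.
Context {R : realType} {c : R} (c_gt0 : 0 < c).

(* Absolutely continuous part of F_c; [phi] vanishes outside [-d, d]. *)
Definition Fc_ac (A : set R) : \bar R :=
  (\int[lebesgue_measure]_(x in A) (phi c x)%:E)%E.

Let Fc_ac0 : Fc_ac set0 = 0%E.
Proof. by rewrite /Fc_ac integral_set0. Qed.

Let Fc_ac_ge0 A : (0 <= Fc_ac A)%E.
Proof. by apply: integral_ge0 => x _; rewrite lee_fin phi_ge0. Qed.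

Let Fc_ac_sigma_additive : semi_sigma_additive Fc_ac.
Proof.
move=> /= F mF tF mUF; rewrite /Fc_ac; apply: cvg_toP.
  apply: ereal_nondecreasing_is_cvgn => m n mn.
  apply: lee_sum_nneg_natr => // k _ _; apply: integral_ge0 => /= x _.
  by rewrite lee_fin phi_ge0.
rewrite ge0_integral_bigcup//=.
- by apply/measurable_funTS/measurableT_comp => //; exact: measurable_phi.
- by move=> x _; rewrite lee_fin phi_ge0.
Qed.

HB.instance Definition _ := isMeasure.Build _ _ _ Fc_ac
  Fc_ac0 Fc_ac_ge0 Fc_ac_sigma_additive.

(* Mass at 0: it is 1 - 1/c if c > 1, and 0 otherwise. *)
Lemma Fc_atom_ge0 : 0 <= Num.max 0 (1 - 1 / c).
Proof. by rewrite le_max lexx. Qed.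

Definition Fc_atom : {nonneg R} := NngNum Fc_atom_ge0.

Definition Fc : {measure set R -> \bar R} :=
  measure_add Fc_ac (mscale Fc_atom \d_(0 : R)).

Definition stieltjes (l : R) : R := \int[Fc]_x (x - l)^-1.

(* Only meaningful for [d c < `|l|], where c^2 m(l)^2 < 1. *)
Definition g (lambda l : R) : R :=
  let m := stieltjes l in
  let q := 1 - c ^+ 2 * m ^+ 2 + Num.sqrt (1 - c ^+ 2 * m ^+ 2) in
  (1 / 2 + 1 / q)^-1 * (c * m / q * (1 + 1 / lambda) + l / lambda).

End distribution.

(* Main.v *)
Require Import Defs.
From mathcomp Require Import all_boot all_order all_algebra.
From mathcomp Require Import all_classical all_reals all_analysis.
From mathcomp Require Import measurable_realfun complex ring lra.
Import Order.TTheory GRing.Theory Num.Theory.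
Import numFieldNormedType.Exports.
Local Open Scope classical_set_scope.
Local Open Scope ring_scope.

Set Implicit Arguments.
Unset Strict Implicit.
Unset Printing Implicit Defensive.

(** With v = - c m and q = 1 - v^2 + sqrt (1 - v^2), for l > d one has
      g(l) = - 2 (1 + 1/lambda) v / (q + 2) + (2/lambda) l q / (q + 2),
    which is increasing, continuous and unbounded as soon as v is nonnegative,
    nonincreasing and < 1; since phi is even, g is odd.  The only hard point is
    c |m| < 1, which has to be extracted from the density.

    Let e = 1 - c.  The equation (1 - c^2 m^2) (c + c z m - 1)^2 = 1 of the
    Stieltjes transform reads S = z v + e with S = (1 - v^2)^(-1/2).  On the
    cut, for 0 < x < d, it is solved by S = X + i T with T = pi c x phi(x),
    where X and T are explicit in x and y0(x); S then runs through an arc of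
    the first quadrant ending at the real point s > 1.  Along this arc
    pi c phi(x) 2d/(d^2 - x^2) dx is the imaginary part of a rational 1-form
    in S whose poles are 0, s and two points of the left half-plane, hence
    the exact differential of a combination of arguments.  Only the arguments
    of S and S - s vary between the ends of the arc, and with k^2 = s^2 - 1
    this bounds the integral of c phi(x) 2d/(d^2 - x^2) over ]0, d[ by
    k/s - max(0, c - 1)/d.  The last term is absorbed by the atom at 0, so
    that c |m(l)| <= k/s < 1 for |l| > d. *)

(** * The edge of the support *)

(** The substitution y = 1 / (s^2 - 1) carries a root of this cubic to a root of the equation of
    [y1], so s witnesses that [y1] exists. The cubic equals - c at 1 and is positive at 2 + c. *)
Lemma edge_root_ex (R : realType) (c : R) : 0 < c ->
  exists2 s : R, 1 < s & s ^+ 3 - 2 * s + (1 - c) = 0.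
Proof.
move=> c0; pose p : {poly R} := 'X^3 - 2%:P * 'X + (1 - c)%:P.
have pE y : p.[y] = y ^+ 3 - 2 * y + (1 - c) by rewrite /p !hornerE.
have c2 : 1 <= 2 + c by lra.
have [|s /andP[s1 _] /rootP ps] := @poly_ivt _ p 1 (2 + c) c2.
  rewrite !pE; apply/andP; split; first by lra.
  have : 0 <= c ^+ 3 by rewrite exprn_ge0// ltW.
  have : 0 <= c ^+ 2 by rewrite exprn_ge0// ltW.
  by rewrite !exprS expr0; lra.
rewrite pE in ps; exists s => //; rewrite lt_neqAle s1 andbT.
by apply/eqP => s1'; move: ps; rewrite -s1'; lra.
Qed.

(* s = sqrt (1 + 1 / y1) and k = 1 / sqrt y1 if c <> 1, s = sqrt 2 and
   k = 1 if c = 1; k < 1 iff c < 1. *)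
Lemma edge_parametrization (R : realType) (c : R) : 0 < c ->
  exists s k : R, [/\ 1 < s, 0 < k, s ^+ 2 = 1 + k ^+ 2,
    1 - c = s * (1 - k ^+ 2) & d c = s ^+ 2 * k].
Proof.
move=> c0; have [->|c1] := eqVneq c 1.
  exists (Num.sqrt 2), 1; rewrite /d eqxx !sqr_sqrtr//.
  rewrite expr1n mulr1; split => //.
    by rewrite -[ltLHS]sqrtr1 ltr_sqrt// ltr1n.
  by rewrite !subrr mulr0.
(* Here q = 1 / y1 is the future k^2. The range imposed on [y1] says that 1 - q has the sign of 1 -
   c, which selects the sign when the square root of the third equation is taken. *)
have [q [q0 q1 eE yE]] : exists q : R, [/\ 0 < q, (0 < 1 - c <-> q < 1),
    (1 - c) ^+ 2 = (1 + q) * (1 - q) ^+ 2 & y1 c = q^-1].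
  have [s s1 ps] := edge_root_ex c0.
  have : exists y, [set y | ((1 - c) ^+ 2 - 1) * y ^+ 3 + y ^+ 2 + y - 1 = 0 /\
                  (if c < 1 then 1 < y else 0 < y < 1)] y.
    have s2 : 0 < s ^+ 2 - 1 by rewrite subr_gt0 exprn_egt1.
    have e1 : 1 - c = 2 * s - s ^+ 3 by lra.
    exists (s ^+ 2 - 1)^-1 => /=; split.
      by rewrite e1; field; rewrite gt_eqF.
    case: ifPn => [cl|cl].
      rewrite invf_gt1// ltrBlDr -(ltr_pM2l (lt_trans ltr01 s1)).
      by rewrite -exprS; lra.
    have cl1 : 1 < c by rewrite lt_neqAle eq_sym c1 leNgt.
    rewrite invr_gt0 s2/= invf_lt1// ltrBrDr.
    rewrite -(ltr_pM2l (lt_trans ltr01 s1)) -exprS; lra.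
  move=> /(xgetPex 0); rewrite -/(y1 c) => -[r1 r2].
  have y0 : 0 < y1 c by case: ifPn r2 => _; [lra|move=> /andP[]].
  exists (y1 c)^-1; split; last by rewrite invrK.
  - by rewrite invr_gt0.
  - rewrite invf_lt1// subr_gt0; case: ifPn r2 => // cl.
    by split => //; lra.
  - have yn0 : y1 c != 0 by rewrite gt_eqF.
    apply/eqP; rewrite -subr_eq0 -(mulrI_eq0 _ (mulfI (expf_neq0 3 yn0))).
    rewrite -r1; apply/eqP; field; exact: yn0.
have q1n : 1 - q != 0.
  apply/eqP => q1'; move: eE; rewrite q1' expr0n mulr0 => /eqP.
  by rewrite expf_eq0/= subr_eq0 eq_sym (negbTE c1).
have sq : (Num.sqrt (1 + q)) ^+ 2 = 1 + q by rewrite sqr_sqrtr//; lra.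
have kq : (Num.sqrt q) ^+ 2 = q by rewrite sqr_sqrtr// ltW.
have s0 : 0 < Num.sqrt (1 + q) by rewrite sqrtr_gt0; lra.
have eE' : 1 - c = Num.sqrt (1 + q) * (1 - q).
  have /eqP : (1 - c) ^+ 2 = (Num.sqrt (1 + q) * (1 - q)) ^+ 2.
    by rewrite exprMn sq.
  rewrite eqf_sqr => /orP[/eqP//|/eqP e1].
  have [cl|cl] := ltP 0 (1 - c).
    have := q1.1 cl => ql; have : 0 < Num.sqrt (1 + q) * (1 - q).
      by rewrite mulr_gt0// subr_gt0.
    by lra.
  have ql : 1 <= q by rewrite leNgt; apply/negP => /q1.2; rewrite ltNge cl.
  have : 0 < Num.sqrt (1 + q) * (q - 1).
    by rewrite mulr_gt0// lt_neqAle subr_ge0 ql andbT eq_sym subr_eq0 eq_sym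
      -subr_eq0.
  by lra.
exists (Num.sqrt (1 + q)), (Num.sqrt q); rewrite sq kq; split => //.
- by rewrite -[ltLHS]sqrtr1 ltr_sqrt//; lra.
- by rewrite sqrtr_gt0.
rewrite /d (negbTE c1) yE eE'.
have -> : 1 + q^-1 = (1 + q) / q by field; rewrite gt_eqF.
rewrite sqrtrM ?sqrtrV; last 2 first.
- by rewrite ltW.
- by lra.
have k0 : Num.sqrt q != 0 by rewrite gt_eqF// sqrtr_gt0.
rewrite -[X in _ = X * _]sq.
have -> : q^-1 - 1 = (1 - q) / q by field; rewrite gt_eqF.
have -> : Num.sqrt (1 + q) * (1 - q) * (Num.sqrt (1 + q) / Num.sqrt q) /
   ((1 - q) / q) = Num.sqrt (1 + q) ^+ 2 * (q / Num.sqrt q).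
  by field; rewrite k0 q1n gt_eqF.
by rewrite -[X in X / _]kq; congr (_ * _); field.
Qed.

(** * The root y0 as a function of x *)

Section derivatives.
Context {R : realType}.
Implicit Types (f : R -> R) (x : R).

Lemma is_derive_sqrt_comp f x df : is_derive x 1 f df -> 0 < f x ->
  is_derive x 1 (fun t => Num.sqrt (f t)) (df / (2 * Num.sqrt (f x))).
Proof.
move=> Df f0; have := @is_derive1_comp _ Num.sqrt f x _ _ (is_derive1_sqrt f0) Df.
by rewrite mulrC.
Qed.

Lemma is_derive_ln_comp f x df : is_derive x 1 f df -> 0 < f x ->
  is_derive x 1 (fun t => ln (f t)) (df / f x).
Proof.
move=> Df f0; have := @is_derive1_comp _ (@ln R) f x _ _ (is_derive1_ln f0) Df.
by rewrite mulrC.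
Qed.

Lemma is_derive_atan_comp f x df : is_derive x 1 f df ->
  is_derive x 1 (fun t => atan (f t)) (df / (1 + f x ^+ 2)).
Proof.
move=> Df; have := @is_derive1_comp _ (@atan R) f x _ _ (is_derive1_atan _) Df.
by rewrite mulrC.
Qed.

End derivatives.

Section y0.
Context {R : realType}.
Variable c : R.
Implicit Types x y : R.

Lemma y0_gt0 x : 0 < x -> 0 < y0 c x.
Proof. by move=> /lt0r_neq0/(y0_spec c)[]. Qed.

Lemma y0_eq x y : 0 < x -> 0 < y ->
  x ^+ 2 * (y ^+ 2 * (1 + y)) = (1 - c) ^+ 2 * y ^+ 2 + 4 * (1 + y) ->
  y0 c x = y.
Proof.
move=> x0 y_gt0 /(y0_rootE c _ (lt0r_neq0 x0)) ry.
have [p r m] := y0_spec c (lt0r_neq0 x0).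
apply/eqP; rewrite eq_le m// andbT leNgt; apply/negP => yy.
by have := y0_root_anti (lt0r_neq0 x0) (lt0r_neq0 x0) y_gt0 yy ry r; rewrite ltxx.
Qed.

Lemma sqr_y0 x : 0 < x ->
  x ^+ 2 = (1 - c) ^+ 2 / (1 + y0 c x) + 4 / y0 c x ^+ 2.
Proof.
move=> x0; have [p r _] := y0_spec c (lt0r_neq0 x0).
have p1 : 1 + y0 c x != 0 by rewrite gt_eqF// addr_gt0.
have pn : y0 c x != 0 by rewrite gt_eqF.
have /(y0_rootE c _ (lt0r_neq0 x0)) r' := r.
apply: (mulIf (mulf_neq0 (expf_neq0 2 pn) p1)); rewrite r'.
by field; rewrite p1 pn.
Qed.

(** The cubic is explicitly solvable for x > 0; this inverse function gives the differentiability of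
    [y0], a root known only through a choice. *)
Definition y0inv y : R := Num.sqrt ((1 - c) ^+ 2 / (1 + y) + 4 / y ^+ 2).

Lemma y0inv_arg_gt0 y : 0 < y -> 0 < (1 - c) ^+ 2 / (1 + y) + 4 / y ^+ 2.
Proof.
move=> y_gt0; rewrite ltr_wpDl// ?divr_gt0 ?exprn_gt0//.
by rewrite divr_ge0 ?sqr_ge0// addr_ge0// ltW.
Qed.

Lemma y0invK y : 0 < y -> y0 c (y0inv y) = y.
Proof.
move=> y_gt0; apply: y0_eq => //.
  by rewrite sqrtr_gt0 y0inv_arg_gt0.
rewrite sqr_sqrtr; last by rewrite ltW// y0inv_arg_gt0.
by field; rewrite !gt_eqF// addr_gt0.
Qed.

Lemma y0K x : 0 < x -> y0inv (y0 c x) = x.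
Proof. by move=> x0; rewrite /y0inv -sqr_y0// sqrtr_sqr gtr0_norm. Qed.

Lemma is_derive_y0 x : 0 < x ->
  is_derive x 1 (y0 c)
   (- (2 * x) / ((1 - c) ^+ 2 / (1 + y0 c x) ^+ 2 + 8 / y0 c x ^+ 3)).
Proof.
move=> x0; set y := y0 c x; have yp : 0 < y by exact: y0_gt0.
have yn : y != 0 by rewrite gt_eqF.
have y1n : 1 + y != 0 by rewrite gt_eqF// addr_gt0.
have D1 (z : R) : 0 < z -> is_derive z 1 y0inv (- ((1 - c) ^+ 2 / (1 + z) ^+ 2 + 8 / z ^+ 3)
     / (2 * y0inv z)).
  move=> zp; have zn : z != 0 by rewrite gt_eqF.
  have z1n : 1 + z != 0 by rewrite gt_eqF// addr_gt0.
  have zz : z ^+ 2 != 0 by rewrite expf_neq0.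
  have H1 : is_derive z 1 (fun z => 1 + z) 1.
    by apply: is_derive_eq; rewrite add0r mulr1.
  have H2 : is_derive z 1 (fun z : R => z ^+ 2) (2 * z).
    by apply: is_derive_eq; rewrite /GRing.scale/=; ring.
  have H3 := is_deriveV (f := fun z => 1 + z) z1n H1.
  have H4 := is_deriveV (f := fun z => z ^+ 2) zz H2.
  have H5 : is_derive z 1 (fun z => (1 - c) ^+ 2 / (1 + z) + 4 / z ^+ 2)
      (- ((1 - c) ^+ 2 / (1 + z) ^+ 2 + 8 / z ^+ 3)).
    apply: is_derive_eq; rewrite /GRing.scale/=.
    by field; rewrite zn z1n.
  exact: (is_derive_sqrt_comp H5 (y0inv_arg_gt0 zp)).
rewrite -{1}(y0K x0) -/y.
have := D1 _ yp; set l := (X in is_derive _ _ _ X) => Dy.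
have -> : - (2 * x) / ((1 - c) ^+ 2 / (1 + y) ^+ 2 + 8 / y ^+ 3) = l^-1.
  by rewrite /l invf_div invrN mulrN mulNr /y y0K.
apply: is_derive_inverse => //.
- near=> z; apply: y0invK; near: z; exact: lt_nbhsr.
- near=> z; apply/differentiable_continuous/derivable1_diffP.
  have zp : 0 < z by near: z; exact: lt_nbhsr.
  by have [] := D1 _ zp.
- rewrite /l mulf_neq0// ?oppr_eq0 ?invr_eq0 gt_eqF//.
    by rewrite ltr_wpDl// ?divr_gt0 ?exprn_gt0// divr_ge0 ?sqr_ge0.
  by rewrite mulr_gt0// y0K.
Unshelve. all: by end_near. Qed.

End y0.

(** * The arc S = X + i T *)

Section curve.
Context {R : realType}.
Implicit Types x y c : R.

(** Put e = 1 - c and M = v S, so that S (S - e) = x M and S^2 = 1 + M^2. If S = X + i T with T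
    nonzero, the imaginary parts give M = X / Y + i Y T with Y = (2 X - e) / x. The real parts then
    give two expressions of T^2, those of [curveT2] and [curveT2E], and their equality is the cubic
    for y = Y^2 - 1. *)
Definition curveY c x : R := Num.sqrt (1 + y0 c x).

Definition curveX c x : R := (x * curveY c x + (1 - c)) / 2.

(* T^2, which is x^2 / 4 times the radicand in phi. *)
Definition curveT2 c x : R :=
  (x ^+ 2 * (y0 c x - 1) - (1 - c) ^+ 2 - 2 * (1 - c) * x / curveY c x) / 4.

Definition curveT c x : R := Num.sqrt (curveT2 c x).

Variable c : R.
Local Notation y := (y0 c).
Local Notation Y := (curveY c).
Local Notation X := (curveX c).
Local Notation T := (curveT c).

Lemma sqr_curveY x : 0 < x -> Y x ^+ 2 = 1 + y x.
Proof. by move=> x0; rewrite sqr_sqrtr// addr_ge0// ltW// y0_gt0. Qed.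

Lemma curveY_gt0 x : 0 < x -> 0 < Y x.
Proof. by move=> x0; rewrite sqrtr_gt0 addr_gt0// y0_gt0. Qed.

Lemma curveX_mul x : 0 < x -> X x * (X x - (1 - c)) = (1 + y x) / y x ^+ 2.
Proof.
move=> x0; have yp := y0_gt0 c x0; rewrite /curveX.
have -> : (x * Y x + (1 - c)) / 2 * ((x * Y x + (1 - c)) / 2 - (1 - c)) =
  (x ^+ 2 * Y x ^+ 2 - (1 - c) ^+ 2) / 4 by field.
rewrite sqr_curveY// (sqr_y0 c x0); field.
by rewrite !gt_eqF// addr_gt0.
Qed.

(** The numbers X and X - (1 - c) have a positive product by [curveX_mul], and their sum x Y is
    positive. *)
Lemma curveX_bounds x : 0 < x -> 0 < X x /\ 1 - c < X x.
Proof.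
move=> x0; have yp := y0_gt0 c x0.
have m0 : 0 < X x * (X x - (1 - c)).
  by rewrite curveX_mul// divr_gt0 ?exprn_gt0// addr_gt0.
have p0 : 0 < X x + (X x - (1 - c)).
  have -> : X x + (X x - (1 - c)) = x * Y x by rewrite /curveX; field.
  by rewrite mulr_gt0// curveY_gt0.
have [Xp|Xn] := ltP 0 (X x).
  by split=> //; rewrite -subr_gt0 -(pmulr_rgt0 _ Xp).
have Xep : 0 < X x - (1 - c) by lra.
by move: m0; rewrite pmulr_lgt0// ltNge Xn.
Qed.

Lemma curveT2E x : 0 < x -> curveT2 c x = 1 / y x - X x ^+ 2 / (1 + y x).
Proof.
move=> x0; have yp := y0_gt0 c x0; have Yp := curveY_gt0 x0.
rewrite /curveT2 /curveX.
have -> : ((x * Y x + (1 - c)) / 2) ^+ 2 / (1 + y x) =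
  (x ^+ 2 + 2 * x * (1 - c) / Y x + (1 - c) ^+ 2 / (1 + y x)) / 4.
  by rewrite -sqr_curveY//; field; rewrite gt_eqF.
rewrite (sqr_y0 c x0); field.
by rewrite !gt_eqF// addr_gt0.
Qed.

Lemma y0_decreasing x x' : 0 < x -> x < x' -> y x' < y x.
Proof.
move=> x0 xx'; have x'0 : 0 < x' by exact: lt_trans xx'.
have yp := y0_gt0 c x0; have yp' := y0_gt0 c x'0.
rewrite ltNge; apply/negP => yy.
have : x ^+ 2 < x' ^+ 2 by rewrite ltrXn2r// ltW.
rewrite ltNge => /negP; apply; rewrite (sqr_y0 c x0) (sqr_y0 c x'0).
apply: lerD.
  by apply: ler_wpM2l; [exact: sqr_ge0|rewrite lef_pV2 ?posrE ?addr_gt0// lerD2l].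
by rewrite ler_pM2l// lef_pV2 ?posrE ?exprn_gt0// lerXn2r// nnegrE ltW.
Qed.

(** X (X - (1 - c)) = 1 / y^2 + 1 / y grows with x because y decreases, and the left-hand side is
    increasing in X on the range of [curveX_bounds]. *)
Lemma curveX_lt x x' : 0 < x -> x < x' -> X x < X x'.
Proof.
move=> x0 xx'; have x'0 : 0 < x' by exact: lt_trans xx'.
have [X0 Xe] := curveX_bounds x0; have [X'0 X'e] := curveX_bounds x'0.
have yp := y0_gt0 c x0; have yp' := y0_gt0 c x'0.
have yy := y0_decreasing x0 xx'.
rewrite ltNge; apply/negP => XX.
have : X x' * (X x' - (1 - c)) <= X x * (X x - (1 - c)).
  by apply: ler_pM; rewrite ?lerD2r ?subr_ge0//; exact: ltW.
rewrite !curveX_mul// leNgt => /negP; apply.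
have E (z : R) : 0 < z -> (1 + z) / z ^+ 2 = z^-1 ^+ 2 + z^-1.
  by move=> z0; field; rewrite gt_eqF.
rewrite !E//; have yV : (y x)^-1 < (y x')^-1 by rewrite ltf_pV2.
by rewrite ltrD// ltrXn2r// ?invr_ge0 ltW.
Qed.

Lemma is_derive_curveY x : 0 < x ->
  is_derive x 1 Y ((derive1 y x) / (2 * Y x)).
Proof.
move=> x0; have Dy := is_derive_y0 c x0.
have -> : derive1 y x = - (2 * x) / ((1 - c) ^+ 2 / (1 + y0 c x) ^+ 2 + 8 / y0 c x ^+ 3).
  by rewrite derive1E; case: Dy.
apply: (is_derive_sqrt_comp _ _); last by rewrite addr_gt0// y0_gt0.
by apply: is_derive_eq; rewrite /GRing.scale/=; ring.
Qed.


Lemma is_derive_curveX x : 0 < x ->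
  is_derive x 1 X ((Y x + x * ((derive1 y x) / (2 * Y x))) / 2).
Proof.
move=> x0; have DY := is_derive_curveY x0.
by apply: is_derive_eq; rewrite /GRing.scale/=; field; rewrite gt_eqF// curveY_gt0.
Qed.

Lemma is_derive_curveT2 x : 0 < x ->
  is_derive x 1 (curveT2 c) ((2 * x * (y x - 1) + x ^+ 2 * derive1 y x
    - 2 * (1 - c) / Y x + 2 * (1 - c) * x * ((derive1 y x) / (2 * Y x)) / Y x ^+ 2) / 4).
Proof.
move=> x0; have DY := is_derive_curveY x0.
have Yn : Y x != 0 by rewrite gt_eqF// curveY_gt0.
have Dy : is_derive x 1 y (derive1 y x).
  by have Dy := is_derive_y0 c x0; rewrite derive1E; split => //; case: Dy.
have DV := is_deriveV Yn DY.
have D2 : is_derive x 1 (fun x : R => x ^+ 2) (2 * x).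
  by apply: is_derive_eq; rewrite /GRing.scale/=; ring.
by apply: is_derive_eq; rewrite /GRing.scale/=; field.
Qed.

Lemma is_derive_curveT x : 0 < x -> 0 < curveT2 c x ->
  is_derive x 1 T (((2 * x * (y x - 1) + x ^+ 2 * derive1 y x
    - 2 * (1 - c) / Y x + 2 * (1 - c) * x * ((derive1 y x) / (2 * Y x)) / Y x ^+ 2) / 4)
    / (2 * T x)).
Proof. by move=> x0 T2; exact: (is_derive_sqrt_comp (is_derive_curveT2 x0)). Qed.

(** Implicit differentiation of [sqr_y0]: the form in which the derivative of [y0] enters
    [curve_real_relations]. *)
Lemma derive1_y0 x : 0 < x ->
  derive1 y x * ((1 - c) ^+ 2 / (1 + y x) ^+ 2 + 8 / y x ^+ 3) = - (2 * x).
Proof.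
move=> x0; have [_] := is_derive_y0 c x0; rewrite derive1E => ->.
rewrite divfK// gt_eqF// ltr_wpDl//.
  by rewrite divr_ge0 ?sqr_ge0.
by rewrite divr_gt0// exprn_gt0// y0_gt0.
Qed.

Lemma phiE x : 0 < c -> 0 < x -> x <= d c -> 0 <= curveT2 c x ->
  phi c x = (c * pi)^-1 * (T x / x).
Proof.
move=> c0 x0 xd T20; rewrite /phi gtr0_norm// xd.
have yp := y0_gt0 c x0; have Yp := curveY_gt0 x0.
have -> : y x ^+ 2 / (1 + y x) - ((1 - c) / x + (Num.sqrt (1 + y x))^-1) ^+ 2
    = (2 / x) ^+ 2 * curveT2 c x.
  rewrite -/(Y x) /curveT2 -sqr_curveY//.
  have -> : y x = Y x ^+ 2 - 1 by rewrite sqr_curveY// addrC addKr.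
  by field; rewrite !gt_eqF.
rewrite sqrtrM ?sqr_ge0// sqrtr_sqr ger0_norm; last by rewrite ltW// divr_gt0.
by rewrite -/(T x); move: (@pi R) (pi_gt0 R) => p p0; field; rewrite !gt_eqF.
Qed.

Section edge.
Variables (s k : R).
Hypotheses (s1 : 1 < s) (k0 : 0 < k) (sk : s ^+ 2 = 1 + k ^+ 2)
  (eE : 1 - c = s * (1 - k ^+ 2)) (dE : d c = s ^+ 2 * k).

Lemma edge_gt0 : 0 < d c.
Proof. by rewrite dE mulr_gt0// exprn_gt0// (lt_trans ltr01). Qed.

Lemma y0_edge : y (d c) = k ^- 2.
Proof.
apply: y0_eq; [exact: edge_gt0|by rewrite invr_gt0 exprn_gt0|].
have -> : d c ^+ 2 = (s ^+ 2) ^+ 2 * k ^+ 2 by rewrite dE; ring.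
have -> : (1 - c) ^+ 2 = s ^+ 2 * (1 - k ^+ 2) ^+ 2 by rewrite eE; ring.
by rewrite sk; field; rewrite gt_eqF.
Qed.

Lemma curveY_edge : Y (d c) = s / k.
Proof.
rewrite /curveY y0_edge.
have -> : 1 + k ^- 2 = (s / k) ^+ 2.
  by rewrite expr_div_n sk; field; rewrite gt_eqF.
by rewrite sqrtr_sqr gtr0_norm// divr_gt0// (lt_trans ltr01).
Qed.

Lemma curveX_edge : X (d c) = s.
Proof.
rewrite /curveX curveY_edge dE eE.
have -> : s ^+ 2 * k * (s / k) = s * s ^+ 2 by field; rewrite gt_eqF.
by rewrite sk; field.
Qed.

Lemma curveT_edge : T (d c) = 0.
Proof.
rewrite /curveT curveT2E ?edge_gt0// curveX_edge y0_edge sk.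
rewrite [X in Num.sqrt X](_ : _ = 0) ?sqrtr0//.
by field; rewrite gt_eqF//= gt_eqF// addr_gt0// exprn_gt0.
Qed.

Lemma curveX_lt_edge x : 0 < x < d c -> X x < s.
Proof. by move=> /andP[x0 xd]; rewrite -curveX_edge curveX_lt. Qed.

Lemma curveT2_gt0 x : 0 < x < d c -> 0 < curveT2 c x.
(* With z = X, e = 1 - c and p = y (z - e), [curveX_mul] gives T^2 = (p - z) / (y p) and p (z p - 1)
   = z - e. The cubic z^3 - 2 z + e has the root s and is negative at z < s, that is z (z^2 - 1) < z
   - e; hence p <= z is impossible. *)
Proof.
move=> xd; have Xs := curveX_lt_edge xd; case/andP: xd => x0 xd.
have [X0 Xe] := curveX_bounds x0; have yp := y0_gt0 c x0.
have XX := curveX_mul x0; rewrite curveT2E//.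
have y1 : 1 + y x = y x ^+ 2 * (X x * (X x - (1 - c))).
  by rewrite XX mulrC divfK// expf_neq0// gt_eqF.
move: (eE) => eE'; set z := X x in X0 Xe y1 Xs *; set e := 1 - c in eE' Xe y1 *.
have cubic : z ^+ 3 - 2 * z + e < 0.
  have -> : z ^+ 3 - 2 * z + e = (z - s) * (z ^+ 2 + s * z + s ^+ 2 - 2).
    rewrite eE'; have -> : 1 - k ^+ 2 = 2 - s ^+ 2 by rewrite sk; ring.
    by ring.
  rewrite nmulr_rlt0 ?subr_lt0//.
  have [ks|ks] := leP 1 (k ^+ 2).
    have : 0 < z ^+ 2 by rewrite exprn_gt0.
    have : 0 < s * z by rewrite mulr_gt0// (lt_trans ltr01).
    by rewrite sk; lra.
  (* When k < 1, the bound z > e gives s z > s e = 1 - k^4 > 1 - k^2 = 2 - s^2. *)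
  have e0 : 0 < e by rewrite eE' mulr_gt0 ?subr_gt0// (lt_trans ltr01).
  have : 0 < s * (z - e) by rewrite mulr_gt0 ?subr_gt0// (lt_trans ltr01).
  have -> : s * (z - e) = s * z - s ^+ 2 * (1 - k ^+ 2) by rewrite eE'; ring.
  have : 0 < z ^+ 2 by rewrite exprn_gt0.
  have : 0 <= k ^+ 2 * (1 - k ^+ 2) by rewrite mulr_ge0 ?sqr_ge0// subr_ge0 ltW.
  by rewrite sk; lra.
pose p := y x * (z - e).
have p0 : 0 < p by rewrite mulr_gt0// subr_gt0.
have pE : p * (z * p - 1) = z - e.
  have -> : p * (z * p - 1) = (y x ^+ 2 * (z * (z - e))) * (z - e) - p by rewrite /p; ring.
  by rewrite -y1 /p; ring.
have zp : z < p.
  rewrite ltNge; apply/negP => pz.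
  have zp1 : 0 < z * p - 1 by rewrite -(pmulr_rgt0 _ p0) pE subr_gt0.
  have : p * (z * p - 1) <= z * (z * z - 1).
    by apply: ler_pM; rewrite ?lerD2r ?ler_pM2l// ltW.
  by rewrite pE leNgt => /negP; apply; move: cubic; rewrite !exprS expr0; lra.
have -> : 1 / y x - z ^+ 2 / (1 + y x) = (p - z) / (y x * p).
  rewrite y1 /p; field; rewrite !gt_eqF//=.
  by rewrite subr_gt0.
by rewrite divr_gt0 ?subr_gt0// mulr_gt0.
Qed.

End edge.

End curve.

(** * Algebraic identities for the kernel along the arc *)

Section kernel_algebra.
Variable F : fieldType.
Implicit Types s k S M x e d Q : F.

(** The two poles other than 0 and s are kept together in a quadratic. Its numerator is split into a
    multiple of its derivative, which integrates to its argument, and a constant, which is the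
    business of [quad_primitive]. *)
Lemma kernel_partial_fractions s k S : s ^+ 2 = 1 + k ^+ 2 ->
  s != 0 -> k != 0 -> S != 0 -> S - s != 0 ->
  S ^+ 2 + 2 * s * k ^+ 2 * S + s ^+ 2 * k ^+ 2 != 0 ->
  2 * (s ^+ 2 - 2) / (s * k) / S - 2 * k / s / (S - s)
  + (s * k)^-1 * ((2 * S + 2 * s * k ^+ 2)
                  / (S ^+ 2 + 2 * s * k ^+ 2 * S + s ^+ 2 * k ^+ 2))
  + 2 * k * (1 - k ^+ 2) / (S ^+ 2 + 2 * s * k ^+ 2 * S + s ^+ 2 * k ^+ 2) =
  - (2 * (s ^+ 2 * k) * (S ^+ 2 + s * S + s ^+ 2 - 2)
     / (S * (S - s) * (S ^+ 2 + 2 * s * k ^+ 2 * S + s ^+ 2 * k ^+ 2))).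
Proof.
move=> sk s0 k0 S0 Ss.
have kk : k ^+ 2 = s ^+ 2 - 1 by rewrite sk addrC addKr.
have kk0 : s ^+ 2 - 1 != 0 by rewrite -kk expf_neq0.
(* Both sides are k times a rational function of k^2, so that k^2 can be eliminated in favour of s^2
   - 1 before [field] is called. *)
have -> : 2 * (s ^+ 2 - 2) / (s * k) = k * (2 * (s ^+ 2 - 2) / (s * k ^+ 2)).
  by field; rewrite s0 k0.
have -> : (s * k)^-1 = k * (s * k ^+ 2)^-1 by field; rewrite s0 k0.
rewrite kk => Q0.
have -> : 2 * k / s = k * (2 / s) by field.
by field; rewrite s0 S0 Ss Q0 kk0.
Qed.

(* M = v S; the primed letters stand for derivatives along the arc. *)
Lemma curve_speed S M S' M' x e :
  S * (S - e) = x * M -> S ^+ 2 = 1 + M ^+ 2 ->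
  (2 * S - e) * S' = M + x * M' -> M * M' = S * S' ->
  S' * (S ^+ 3 - 2 * S + e) = M ^+ 3.
Proof.
move=> A B C D.
have -> : S' * (S ^+ 3 - 2 * S + e) =
    (2 * S - e) * S' * (S ^+ 2 - 1) - S' * (S * (S * (S - e))) by ring.
rewrite C A B.
have -> : S' * (S * (x * M)) = (S * S') * (x * M) by ring.
by rewrite -D; ring.
Qed.

(** Two factorizations at the edge: S^3 - 2 S + e = (S - s) (S^2 + s S + s^2 - 2), which with
    [curve_speed] determines S', and M^2 (d^2 - x^2) = - (S - s)^2 Q, where Q is the quadratic and x
    M has been replaced by S (S - e). For S = X + i T the right-hand side of the conclusion has
    imaginary part 2 d T / (x (d^2 - x^2)). *)
Lemma kernel_curve s k S M S' M' x e d : s ^+ 2 = 1 + k ^+ 2 ->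
  e = s * (1 - k ^+ 2) -> d = s ^+ 2 * k ->
  s != 0 -> k != 0 -> S != 0 -> M != 0 -> S - s != 0 -> x != 0 ->
  d ^+ 2 - x ^+ 2 != 0 ->
  S * (S - e) = x * M -> S ^+ 2 = 1 + M ^+ 2 ->
  (2 * S - e) * S' = M + x * M' -> M * M' = S * S' ->
  S ^+ 2 + 2 * s * k ^+ 2 * S + s ^+ 2 * k ^+ 2 != 0 /\
  (2 * (s ^+ 2 - 2) / (s * k) / S - 2 * k / s / (S - s)
  + (s * k)^-1 * ((2 * S + 2 * s * k ^+ 2)
                  / (S ^+ 2 + 2 * s * k ^+ 2 * S + s ^+ 2 * k ^+ 2))
  + 2 * k * (1 - k ^+ 2) / (S ^+ 2 + 2 * s * k ^+ 2 * S + s ^+ 2 * k ^+ 2)) * S'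
  = 2 * d * (S - e) / (x * (d ^+ 2 - x ^+ 2)).
Proof.
move=> sk eE dE s0 k0 S0 M0 Ss x0 dx A B C D.
have kk : k ^+ 2 = s ^+ 2 - 1 by rewrite sk addrC addKr.
have V := curve_speed A B C D.
set Q := S ^+ 2 + _ + _.
have QE : (S - s) ^+ 2 * Q = - (M ^+ 2 * (d ^+ 2 - x ^+ 2)).
  have -> : M ^+ 2 * (d ^+ 2 - x ^+ 2) =
      (S ^+ 2 - 1) * d ^+ 2 - (S * (S - e)) ^+ 2 by rewrite A B; ring.
  have -> : d ^+ 2 = s ^+ 2 * (s ^+ 2 * k ^+ 2) by rewrite dE; ring.
  by rewrite /Q eE kk; ring.
have Q0 : Q != 0.
  apply/eqP => Q0; move: QE; rewrite Q0 mulr0 => /esym/eqP.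
  by rewrite oppr_eq0 mulf_eq0 expf_eq0/= (negbTE M0) (negbTE dx).
split=> //; rewrite kernel_partial_fractions//.
have N : S' * ((S - s) * (S ^+ 2 + s * S + s ^+ 2 - 2)) = M ^+ 3.
  by rewrite -V eE kk; ring.
have -> : S - e = x * M / S by rewrite -A mulrAC mulfV ?mul1r.
rewrite -dE -/Q.
have -> : - (2 * d * (S ^+ 2 + s * S + s ^+ 2 - 2) / (S * (S - s) * Q)) * S'
  = - (2 * d * (S' * ((S - s) * (S ^+ 2 + s * S + s ^+ 2 - 2)))
       / (S * ((S - s) ^+ 2 * Q))) by field; rewrite S0 Ss Q0.
rewrite N QE; field.
by rewrite dx x0 S0 oppr_eq0 mulf_neq0// expf_neq0.
Qed.

End kernel_algebra.

Section real_relations.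
Variable F : fieldType.
(** Real parts of the last four equations assumed in [kernel_curve], for S = X + i T and M = (x + e
    / Y) / 2 + i Y T; [TT'] stands for the product of T and its derivative. The imaginary parts
    follow from the shape of M alone. *)
Lemma curve_real_relations (x e Y dy X X' T T2 TT' : F) (y := Y ^+ 2 - 1) (Y' := dy / (2 * Y)) :
  2 != 0 :> F -> Y != 0 -> y != 0 ->
  X = (x * Y + e) / 2 -> X' = (Y + x * Y') / 2 ->
  T2 = 1 / y - X ^+ 2 / Y ^+ 2 ->
  T2 = (x ^+ 2 * (y - 1) - e ^+ 2 - 2 * e * x / Y) / 4 ->
  TT' = (2 * x * (y - 1) + x ^+ 2 * dy
    - 2 * e / Y + 2 * e * x * Y' / Y ^+ 2) / 4 / 2 ->
  x ^+ 2 = e ^+ 2 / Y ^+ 2 + 4 / y ^+ 2 ->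
  dy * (e ^+ 2 / (Y ^+ 2) ^+ 2 + 8 / y ^+ 3) = - (2 * x) ->
  [/\ X ^+ 2 - T2 - e * X = x * ((x + e / Y) / 2),
      X ^+ 2 - T2 = 1 + ((x + e / Y) / 2) ^+ 2 - Y ^+ 2 * T2,
      (2 * X - e) * X' - 2 * TT' = (x + e / Y) / 2 + x * ((1 - e * Y' / Y ^+ 2) / 2) &
      (x + e / Y) / 2 * ((1 - e * Y' / Y ^+ 2) / 2) - Y * Y' * T2 - Y ^+ 2 * TT' = X * X' - TT'].
Proof.
move=> n2 Y0 y0 XE X'E T2y T2E TE x2 dyE.
have n4 : 4 != 0 :> F by rewrite (_ : 4 = 2 * 2) ?mulf_neq0//; ring.
split.
- by rewrite T2E XE /y; field; rewrite n2 Y0 n4.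
- have -> : X ^+ 2 - T2 = X ^+ 2 - Y ^+ 2 * T2 + y * T2 by rewrite /y; ring.
  by rewrite {2}T2y XE /y; field; rewrite -/y y0 n2 Y0.
- by rewrite TE X'E XE /Y' /y; field; rewrite n2 Y0 n4.
(* This is the derivative of the other expression 1 / y - X^2 / Y^2 of T^2; the two derivatives
   differ by a combination of [x2] and [dyE]. *)
have TE' : TT' = (- dy / y ^+ 2 - 2 * X * X' / Y ^+ 2 + 2 * X ^+ 2 * Y' / Y ^+ 3) / 2.
  apply/eqP; rewrite -subr_eq0; apply/eqP.
  transitivity ((y * (dy * (e ^+ 2 / (Y ^+ 2) ^+ 2 + 8 / y ^+ 3) + 2 * x)
     - dy * (e ^+ 2 / Y ^+ 2 + 4 / y ^+ 2 - x ^+ 2)) / 4 / 2); last first.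
    by rewrite dyE x2; ring.
  by rewrite TE X'E XE /Y' /y; field; rewrite -/y y0 n2 Y0 n4.
have -> : X * X' - TT' = X * X' - Y ^+ 2 * TT' + y * TT' by rewrite /y; ring.
rewrite {3}TE' T2y X'E XE /Y' /y; field; rewrite -/y y0 n2 Y0//.
Qed.
End real_relations.

(** * A primitive of the kernel *)

Section arguments.
Context {R : realType}.
Implicit Types (a b u v x s k : R) (f g : R -> R).

Definition im_quot a b u v : R := (b * u - a * v) / (u ^+ 2 + v ^+ 2).

Lemma Im_quot a b u v :
  complex.Im ((a +i* b) / (u +i* v))%C = im_quot a b u v.
Proof. by rewrite /im_quot; simpc => /=; ring. Qed.

(** Up to a multiple of pi, atan (g / f) is an argument of f + i g, so its derivative is the
    imaginary part of the logarithmic derivative, whatever the sign of f. *)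
Lemma is_derive_arg f g x df dg : is_derive x 1 f df -> is_derive x 1 g dg ->
  f x != 0 ->
  is_derive x 1 (fun t => atan (g t / f t)) (im_quot df dg (f x) (g x)).
Proof.
move=> Df Dg f0; have DV := is_deriveV f0 Df.
have D : is_derive x 1 (fun t => g t / f t) ((dg * f x - df * g x) / f x ^+ 2).
  by apply: is_derive_eq; rewrite /GRing.scale/=; field.
have := is_derive_atan_comp D; set l := (X in is_derive _ _ _ X) => D'.
apply: is_derive_eq; rewrite /l /im_quot.
have fp : 0 < f x ^+ 2 by rewrite exprn_even_gt0.
have n : f x ^+ 2 + g x ^+ 2 != 0 by rewrite gt_eqF// ltr_wpDr// sqr_ge0.
have -> : 1 + (g x / f x) ^+ 2 = (f x ^+ 2 + g x ^+ 2) / f x ^+ 2 by field.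
by field; rewrite f0 n.
Qed.

(* Real and imaginary parts of S^2 + 2 s k^2 S + s^2 k^2 at S = u + iv. *)
Definition quadr s k u v := u ^+ 2 - v ^+ 2 + 2 * s * k ^+ 2 * u + s ^+ 2 * k ^+ 2.
Definition quadi s k u v := v * (2 * u + 2 * s * k ^+ 2).

Lemma cvg_sqr {T : Type} {F : set_system T} {FF : Filter F} (f : T -> R) a :
  f @ F --> a -> (fun t => f t ^+ 2) @ F --> a ^+ 2.
Proof. by move=> fa; rewrite expr2; apply: cvgM. Qed.

Lemma cvg_arg {T : Type} {F : set_system T} {FF : Filter F} (f g : T -> R) a :
  f @ F --> a -> g @ F --> (0 : R) -> a != 0 -> (fun t => atan (g t / f t)) @ F --> (0 : R).
Proof.
move=> fa g0 a0; rewrite -(@atan0 R); apply: continuous_cvg.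
  exact: continuous_atan.
by rewrite -(mul0r a^-1); apply: cvgM => //; exact: cvgV.
Qed.

(* Th (Re S) (Im S) is a primitive of the imaginary part of
   2 k (1 - k^2) dS / (S^2 + 2 s k^2 S + s^2 k^2), vanishing on the real axis:
   a difference of arguments or of logarithms of moduli, according to whether
   the roots are real (k > 1) or not (k < 1). *)
Definition quad_primitive s k (Th : R -> R -> R) := [/\
    forall u, 0 <= u -> Th u 0 = 0,
    (forall f g x df dg, 0 < f x -> is_derive x 1 f df -> is_derive x 1 g dg ->
      is_derive x 1 (fun t => Th (f t) (g t))
        (2 * k * (1 - k ^+ 2)
         * im_quot df dg (quadr s k (f x) (g x)) (quadi s k (f x) (g x)))) &
    (forall (T : Type) (F : set_system T) (FF : Filter F) (f g : T -> R) a,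
      0 <= a -> f @ F --> a -> g @ F --> (0 : R) ->
      (fun t => Th (f t) (g t)) @ F --> (0 : R))].

Lemma quad_primitive_ex_gt1 s k : 0 < s -> 1 < k -> exists Th, quad_primitive s k Th.
Proof.
move=> s0 k1; have k0 : 0 < k by exact: lt_trans k1.
have kk : 0 < k ^+ 2 - 1 by rewrite subr_gt0 exprn_egt1.
(* w^2 is a quarter of the discriminant of the quadratic Q, whose roots are - h1 and - h2, and 1 / Q
   = (1 / (S + h1) - 1 / (S + h2)) / (2 w). *)
pose w := s * k * Num.sqrt (k ^+ 2 - 1).
have w0 : 0 < w by rewrite !mulr_gt0// sqrtr_gt0.
have ww : w ^+ 2 = s ^+ 2 * k ^+ 2 * (k ^+ 2 - 1).
  by rewrite !exprMn sqr_sqrtr// ltW.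
pose h1 := s * k ^+ 2 - w; pose h2 := s * k ^+ 2 + w.
have h2_gt0 : 0 < h2 by rewrite addr_gt0// mulr_gt0// exprn_gt0.
have h12 : h1 * h2 = s ^+ 2 * k ^+ 2.
  have -> : h1 * h2 = s ^+ 2 * (k ^+ 2) ^+ 2 - w ^+ 2 by rewrite /h1 /h2; ring.
  by rewrite ww; ring.
have h1_gt0 : 0 < h1 by rewrite -(pmulr_lgt0 _ h2_gt0) h12 mulr_gt0// exprn_gt0.
exists (fun u v => 2 * k * (1 - k ^+ 2) / (2 * w)
  * (atan (v / (u + h1)) - atan (v / (u + h2)))); split.
- by move=> u u0; rewrite !mul0r subrr mulr0.
- move=> f g x df dg f0 Df Dg.
  have D h : 0 < h -> is_derive x 1 (fun t => atan (g t / (f t + h)))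
      (im_quot df dg (f x + h) (g x)).
    move=> h0; apply: is_derive_arg; last by rewrite gt_eqF// addr_gt0.
    by apply: is_derive_eq; rewrite addr0.
  have D1 := D _ h1_gt0; have D2 := D _ h2_gt0.
  apply: is_derive_eq; rewrite /GRing.scale/= /im_quot.
  have E : quadr s k (f x) (g x) ^+ 2 + quadi s k (f x) (g x) ^+ 2 =
     ((f x + h1) ^+ 2 + g x ^+ 2) * ((f x + h2) ^+ 2 + g x ^+ 2).
    by rewrite /quadr /quadi -h12 /h1 /h2; ring.
  have P h : 0 < h -> (f x + h) ^+ 2 + g x ^+ 2 != 0.
    by move=> h0; rewrite gt_eqF// ltr_wpDr ?sqr_ge0// exprn_gt0// addr_gt0.
  rewrite E.
  have -> : dg * quadr s k (f x) (g x) - df * quadi s k (f x) (g x) =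
    dg * (f x ^+ 2 - g x ^+ 2 + (h1 + h2) * f x + h1 * h2)
    - df * (g x * (2 * f x + (h1 + h2))).
    by rewrite h12 /quadr /quadi /h1 /h2; ring.
  have -> : w = (h2 - h1) / 2 by rewrite /h1 /h2; field.
  have h21 : h2 - h1 != 0.
    have -> : h2 - h1 = 2 * w by rewrite /h1 /h2; ring.
    by rewrite mulf_neq0 ?gt_eqF.
  by field; rewrite h21 !P.
- move=> T F FF f g a a0 fa g0.
  have C h : 0 < h -> (fun t => atan (g t / (f t + h))) @ F --> (0 : R).
    move=> h0; apply: (@cvg_arg _ _ _ _ _ (a + h)) => //.
      by apply: cvgD => //; exact: cvg_cst.
    by rewrite gt_eqF// ltr_wpDl.
  rewrite -[X in _ --> X](mulr0 (2 * k * (1 - k ^+ 2) / (2 * w))).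
  apply: cvgM; first exact: cvg_cst.
  rewrite -[X in _ --> X](subrr 0).
  by apply: cvgB; exact: C.
Qed.

Lemma quad_primitive_ex_lt1 s k : 0 < s -> 0 < k < 1 -> exists Th, quad_primitive s k Th.
Proof.
move=> s0 /andP[k0 k1].
have kk : 0 < 1 - k ^+ 2 by rewrite subr_gt0 exprn_ilt1 ?ltW.
(* The roots are - h + i w and - h - i w, and 1 / Q = (1 / (S + h - i w) - 1 / (S + h + i w)) / (2 i
   w). Dividing by i turns arguments into logarithms of moduli; with squared moduli the denominator
   becomes 4 w. *)
pose w := s * k * Num.sqrt (1 - k ^+ 2).
have w0 : 0 < w by rewrite !mulr_gt0// sqrtr_gt0.
have ww : w ^+ 2 = s ^+ 2 * k ^+ 2 * (1 - k ^+ 2).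
  by rewrite !exprMn sqr_sqrtr// ltW.
pose h := s * k ^+ 2.
have h0 : 0 < h by rewrite mulr_gt0// exprn_gt0.
have hw : h ^+ 2 + w ^+ 2 = s ^+ 2 * k ^+ 2 by rewrite ww /h; ring.
have P (u v : R) : 0 <= u -> 0 < (u + h) ^+ 2 + v ^+ 2.
  by move=> u0; rewrite ltr_wpDr ?sqr_ge0// exprn_gt0// ltr_wpDl.
exists (fun u v => - (2 * k * (1 - k ^+ 2) / (4 * w))
  * (ln ((u + h) ^+ 2 + (v - w) ^+ 2) - ln ((u + h) ^+ 2 + (v + w) ^+ 2))); split.
- by move=> u u0; rewrite !add0r sqrrN subrr mulr0.
- move=> f g x df dg /[dup] f0 /ltW fx0 Df Dg.
  have D b : is_derive x 1 (fun t => ln ((f t + h) ^+ 2 + (g t + b) ^+ 2))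
      ((2 * df * (f x + h) + 2 * dg * (g x + b)) / ((f x + h) ^+ 2 + (g x + b) ^+ 2)).
    apply: is_derive_ln_comp; last exact: P.
    have Dh : is_derive x 1 (fun t => f t + h) df.
      by apply: is_derive_eq; rewrite addr0.
    have Db : is_derive x 1 (fun t => g t + b) dg.
      by apply: is_derive_eq; rewrite addr0.
    by apply: is_derive_eq; rewrite /GRing.scale/=; ring.
  have D1 := D (- w); have D2 := D w.
  apply: is_derive_eq; rewrite /GRing.scale/= /im_quot.
  have E : quadr s k (f x) (g x) ^+ 2 + quadi s k (f x) (g x) ^+ 2 =
     ((f x + h) ^+ 2 + (g x - w) ^+ 2) * ((f x + h) ^+ 2 + (g x + w) ^+ 2).
    by rewrite /quadr /quadi -hw /h; ring.
  rewrite E.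
  have -> : dg * quadr s k (f x) (g x) - df * quadi s k (f x) (g x) =
    dg * (f x ^+ 2 - g x ^+ 2 + 2 * h * f x + h ^+ 2 + w ^+ 2)
    - df * (2 * g x * (f x + h)).
    by rewrite -addrA hw /quadr /quadi /h; ring.
  by field; rewrite !gt_eqF//=; apply: P.
- move=> T F FF f g a a0 fa g0.
  have C b : (fun t => ln ((f t + h) ^+ 2 + (g t + b) ^+ 2)) @ F
       --> ln ((a + h) ^+ 2 + (0 + b) ^+ 2).
    apply: continuous_cvg; first by apply: continuous_ln; exact: P.
    by apply: cvgD; apply: cvg_sqr; apply: cvgD => //; exact: cvg_cst.
  rewrite -[X in _ --> X](mulr0 (- (2 * k * (1 - k ^+ 2) / (4 * w)))).
  apply: cvgM; first exact: cvg_cst.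
  rewrite -[X in _ --> X](subrr (ln ((a + h) ^+ 2 + (0 + w) ^+ 2))).
  apply: cvgB; last exact: C.
  by have := C (- w); rewrite add0r sqrrN -{2}[w]add0r; exact.
Qed.

Lemma quad_primitive_ex s k : 0 < s -> 0 < k -> exists Th, quad_primitive s k Th.
Proof.
move=> s0 k0; have [k1|k1|k1] := ltgtP k 1.
- by apply: quad_primitive_ex_lt1; rewrite ?k0.
- exact: quad_primitive_ex_gt1.
exists (fun _ _ => 0); split=> //.
- move=> f g x df dg _ _ _; rewrite k1 expr1n subrr mulr0 mul0r.
  exact: is_derive_cst.
- by move=> T F FF f g a _ _ _; exact: cvg_cst.
Qed.

End arguments.

Lemma Im_comb (R : rcfType) (a1 a2 a3 a4 : R) (z1 z2 z3 z4 : R[i]) :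
  complex.Im (a1%:C * z1 - a2%:C * z2 + a3%:C * z3 + a4%:C * z4)%C =
  a1 * complex.Im z1 - a2 * complex.Im z2 + a3 * complex.Im z3 + a4 * complex.Im z4.
Proof. by case: z1 z2 z3 z4 => ? ? [? ?] [? ?] [? ?]; simpc. Qed.

Section primitive.
Context {R : realType}.
Variables (c s k : R).
Hypotheses (s1 : 1 < s) (k0 : 0 < k) (sk : s ^+ 2 = 1 + k ^+ 2)
  (eE : 1 - c = s * (1 - k ^+ 2)) (dE : d c = s ^+ 2 * k).
Implicit Types x : R.
Local Notation y := (y0 c).
Local Notation Y := (curveY c).
Local Notation X := (curveX c).
Local Notation T := (curveT c).

Let s0 : 0 < s. Proof. exact: lt_trans s1. Qed.

(** On ]0, d[ the first factor is pi c phi(x) by [phiE]; the second is 1 / (d - x) + 1 / (d + x),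
    from folding the even density onto the positive half-line. *)
Definition edge_kernel x : R := T x / x * (2 * d c / (d c ^+ 2 - x ^+ 2)).

(** Since y is at least its edge value 1 / k^2, T^2 <= k^2 < s^2 k^2. The quadratic therefore stays
    in the right half-plane, where [atan] of the slope is its argument. *)
Lemma quadr_curve_gt0 x : 0 < x <= d c -> 0 < quadr s k (X x) (T x).
Proof.
move=> /andP[x0 xd]; have [X0 _] := curveX_bounds c x0.
have yp := y0_gt0 c x0.
have yk : k ^- 2 <= y x.
  rewrite -(y0_edge s1 k0 sk eE dE); move: xd; rewrite le_eqVlt => /predU1P[->//|xd].
  by rewrite ltW// y0_decreasing.
have : T x ^+ 2 <= k ^+ 2.
  have [T2|T2] := leP (curveT2 c x) 0.
    by rewrite /curveT (ler0_sqrtr T2) expr0n/= sqr_ge0.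
  rewrite sqr_sqrtr ?(ltW T2)// curveT2E//.
  have : 1 / y x <= k ^+ 2.
    by rewrite div1r -[k ^+ 2]invrK lef_pV2// posrE ?invr_gt0 exprn_gt0.
  have : 0 <= X x ^+ 2 / (1 + y x) by rewrite divr_ge0 ?sqr_ge0// addr_ge0// ltW.
  by lra.
have : 0 < X x ^+ 2 by rewrite exprn_gt0.
have : 0 < s * k ^+ 2 * X x by rewrite mulr_gt0// mulr_gt0// exprn_gt0.
have : k ^+ 2 < s ^+ 2 * k ^+ 2.
  by rewrite -subr_gt0 -[X in _ - X]mul1r -mulrBl mulr_gt0 ?exprn_gt0// subr_gt0
    exprn_egt1.
by rewrite /quadr; lra.
Qed.

Local Notation dX x := ((Y x + x * (derive1 y x / (2 * Y x))) / 2).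
Local Notation dT x := (((2 * x * (y x - 1) + x ^+ 2 * derive1 y x
    - 2 * (1 - c) / Y x + 2 * (1 - c) * x * (derive1 y x / (2 * Y x)) / Y x ^+ 2) / 4)
    / (2 * T x)).

(** Imaginary part of [kernel_curve] over the complex numbers, with S = X + i T. *)
Lemma edge_kernel_arg x : 0 < x < d c ->
  2 * (s ^+ 2 - 2) / (s * k) * im_quot (dX x) (dT x) (X x) (T x)
  - 2 * k / s * im_quot (dX x) (dT x) (X x - s) (T x)
  + (s * k)^-1 * im_quot
      (2 * X x * dX x - 2 * T x * dT x + 2 * s * k ^+ 2 * dX x)
      (dT x * (2 * X x + 2 * s * k ^+ 2) + T x * (2 * dX x))
      (quadr s k (X x) (T x)) (quadi s k (X x) (T x))
  + 2 * k * (1 - k ^+ 2) * im_quot (dX x) (dT x)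
      (quadr s k (X x) (T x)) (quadi s k (X x) (T x)) = edge_kernel x.
Proof.
move=> xd; have T2 := curveT2_gt0 s1 k0 sk eE dE xd.
case/andP: (xd) => x0 xltd.
have T0 : 0 < T x by rewrite sqrtr_gt0.
have yp := y0_gt0 c x0; have Yp := curveY_gt0 c x0.
have Y2 := sqr_curveY c x0; have [X0 Xe] := curveX_bounds c x0.
have yE : y x = Y x ^+ 2 - 1 by rewrite Y2 addrC addKr.
have TT : T x ^+ 2 = curveT2 c x by rewrite sqr_sqrtr// ltW.
have dx : d c ^+ 2 - x ^+ 2 != 0.
  by rewrite subr_eq0 eq_sym lt_eqF// ltrXn2r// ltW// edge_gt0.
have [HA HB HC HD] : [/\
      X x ^+ 2 - T x ^+ 2 - (1 - c) * X x = x * ((x + (1 - c) / Y x) / 2),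
      X x ^+ 2 - T x ^+ 2 =
        1 + ((x + (1 - c) / Y x) / 2) ^+ 2 - Y x ^+ 2 * T x ^+ 2,
      (2 * X x - (1 - c)) * dX x - 2 * (T x * dT x) =
        (x + (1 - c) / Y x) / 2
        + x * ((1 - (1 - c) * (derive1 y x / (2 * Y x)) / Y x ^+ 2) / 2) &
      (x + (1 - c) / Y x) / 2
        * ((1 - (1 - c) * (derive1 y x / (2 * Y x)) / Y x ^+ 2) / 2)
        - Y x * (derive1 y x / (2 * Y x)) * T x ^+ 2 - Y x ^+ 2 * (T x * dT x)
      = X x * dX x - T x * dT x].
  have Hdy := derive1_y0 c x0; have Hx := sqr_y0 c x0; have HT := curveT2E c x0.
  move: Hdy Hx HT TT; rewrite -Y2 yE => Hdy Hx HT TT.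
  apply: curve_real_relations => //; try by rewrite ?gt_eqF// -yE.
  - by rewrite TT.
  by field; rewrite !gt_eqF.
pose S := (X x +i* T x)%C; pose S' := (dX x +i* dT x)%C.
pose M := ((x + (1 - c) / Y x) / 2 +i* (Y x * T x))%C.
pose M' := ((1 - (1 - c) * (derive1 y x / (2 * Y x)) / Y x ^+ 2) / 2 +i*
   ((derive1 y x / (2 * Y x)) * T x + Y x * dT x))%C.
have Cne (a b : R) : b != 0 -> (a +i* b)%C != 0.
  by move=> b0; rewrite eq_complex/= (negbTE b0) andbF.
have Cr (a : R) : a != 0 -> a%:C%C != 0.
  by move=> a0; rewrite eq_complex/= (negbTE a0).
have T0' : T x != 0 by rewrite gt_eqF.
have A : S * (S - (1 - c)%:C%C) = x%:C%C * M.
  rewrite /S /M /real_complex_def /=; simpc; congr (_ +i* _)%C.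
    by rewrite -HA; ring.
  by rewrite /curveX; field.
have B : S ^+ 2 = 1 + M ^+ 2.
  rewrite /S /M !expr2 /=; simpc; congr (_ +i* _)%C.
    by rewrite -[LHS]/(X x * X x - T x * T x) -!expr2 HB; ring.
  by rewrite /curveX; field; rewrite gt_eqF.
have C : (2 * S - (1 - c)%:C%C) * S' = M + x%:C%C * M'.
  rewrite mulr_natl mulr2n /S /M /S' /M' /=; simpc; congr (_ +i* _)%C.
    by rewrite -HC; ring.
  by rewrite /curveX; field; rewrite !gt_eqF.
have D : M * M' = S * S'.
  rewrite /S /M /S' /M' /=; simpc; congr (_ +i* _)%C.
    by rewrite -HD; ring.
  by rewrite /curveX; field; rewrite !gt_eqF.
have [] := @kernel_curve R[i] s%:C%C k%:C%C S M S' M' x%:C%C (1 - c)%:C%C (d c)%:C%C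
    _ _ _ _ _ _ _ _ _ _ A B C D.
- by rewrite -!rmorphXn/= sk rmorphD rmorph1.
- by rewrite eE rmorphM rmorphB rmorph1 rmorphXn.
- by rewrite dE rmorphM rmorphXn.
- by rewrite Cr ?gt_eqF.
- by rewrite Cr ?gt_eqF.
- exact: Cne.
- by apply: Cne; rewrite mulf_neq0// gt_eqF.
- by rewrite /S /=; simpc; exact: Cne.
- by rewrite Cr ?gt_eqF.
- by rewrite -!rmorphXn -rmorphB Cr.
move=> _ E.
have nC : (2 : R)%:C%C = 2 by rewrite rmorph_nat.
(* Each term becomes a real coefficient times a quotient with S' in the numerator, the shape handled
   by [Im_comb] and [Im_quot]. *)
have {}E : (2 * (s ^+ 2 - 2) / (s * k))%:C%C * (S' / S)
    - (2 * k / s)%:C%C * (S' / (S - s%:C%C))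
    + ((s * k)^-1)%:C%C * ((2 * S + 2 * s%:C%C * k%:C%C ^+ 2) * S'
        / (S ^+ 2 + 2 * s%:C%C * k%:C%C ^+ 2 * S + s%:C%C ^+ 2 * k%:C%C ^+ 2))
    + (2 * k * (1 - k ^+ 2))%:C%C * (S'
        / (S ^+ 2 + 2 * s%:C%C * k%:C%C ^+ 2 * S + s%:C%C ^+ 2 * k%:C%C ^+ 2))
  = (2 * d c / (x * (d c ^+ 2 - x ^+ 2)))%:C%C * ((S - (1 - c)%:C%C) / 1).
  rewrite !(rmorphM, rmorphB, fmorphV, rmorphXn, rmorph1, rmorph_nat) divr1 [RHS]mulrAC.
  by rewrite !(rmorphM, rmorphB, fmorphV, rmorphXn, rmorph1, rmorph_nat) in E; rewrite -E; ring.
have SsE : S - s%:C%C = ((X x - s) +i* T x)%C by rewrite /S /=; simpc.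
have QE : S ^+ 2 + 2 * s%:C%C * k%:C%C ^+ 2 * S + s%:C%C ^+ 2 * k%:C%C ^+ 2
   = (quadr s k (X x) (T x) +i* quadi s k (X x) (T x))%C.
  rewrite -nC -!rmorphXn -!rmorphM /S /quadr /quadi expr2; simpc.
  by congr (_ +i* _)%C; ring.
have dQE : (2 * S + 2 * s%:C%C * k%:C%C ^+ 2) * S' =
   ((2 * X x * dX x - 2 * T x * dT x + 2 * s * k ^+ 2 * dX x) +i*
      (dT x * (2 * X x + 2 * s * k ^+ 2) + T x * (2 * dX x)))%C.
  rewrite -nC -!rmorphXn -!rmorphM /S /S'; simpc.
  by congr (_ +i* _)%C; ring.
move: E; rewrite SsE QE dQE => /(congr1 (@complex.Im R)).
rewrite Im_comb /S /S' !Im_quot => ->.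
rewrite /edge_kernel /S divr1; simpc => /=.
by field; rewrite dx gt_eqF.
Qed.

End primitive.

(** * The arc near x = 0 *)

Section curve_at_0.
Context {R : realType}.
Variable c : R.
Implicit Types x : R.
Local Notation y := (y0 c).
Local Notation X := (curveX c).
Local Notation T := (curveT c).

Lemma y0_inv_le x : 0 < x -> (y x)^-1 <= x / 2.
Proof.
move=> x0; have yp := y0_gt0 c x0.
have : (2 / y x) ^+ 2 <= x ^+ 2.
  rewrite (sqr_y0 c x0) expr_div_n -natrX lerDr divr_ge0 ?sqr_ge0//.
  by rewrite addr_ge0// ltW.
rewrite ler_pXn2r ?nnegrE ?divr_ge0 ?(ltW x0) ?(ltW yp)//.
by rewrite mulrC; lra.
Qed.

Lemma cvg_sqrt_at_right0 (f : R -> R) : continuous f -> f 0 = 0 ->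
  Num.sqrt (f x) @[x --> 0^'+] --> 0.
Proof.
move=> cf f0; apply: cvg_at_right_filter.
suff : Num.sqrt (f x) @[x --> 0] --> Num.sqrt (f 0) by rewrite f0 sqrtr0.
apply: (@continuous_comp _ _ _ f (@Num.sqrt R)); first exact: cf.
exact: sqrt_continuous.
Qed.

Lemma cvg_curveT_at_right0 : T x @[x --> 0^'+] --> 0.
Proof.
apply: (@squeeze_cvgr _ _ _ _ (cst 0) (fun x => Num.sqrt (x / 2))).
- near=> x; have x0 : 0 < x by [].
  rewrite sqrtr_ge0 ler_wsqrtr// curveT2E// div1r.
  have := y0_inv_le x0.
  have : 0 <= X x ^+ 2 / (1 + y x).
    by rewrite divr_ge0 ?sqr_ge0// addr_ge0// ltW// y0_gt0.
  by lra.
- exact: cvg_cst.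
- apply: cvg_sqrt_at_right0; last by rewrite mul0r.
  by move=> x; exact: mulrr_continuous.
Unshelve. all: by end_near. Qed.

(** With m the limit, (X - m)^2 <= X (X - (1 - c)) = 1 / y^2 + 1 / y, and 1 / y <= x / 2. *)
Lemma cvg_curveX_at_right0 : X x @[x --> 0^'+] --> Num.max (1 - c) 0.
Proof.
apply: (@squeeze_cvgr _ _ _ _ (cst (Num.max (1 - c) 0))
  (fun x => Num.max (1 - c) 0 + Num.sqrt (x ^+ 2 / 4 + x / 2))).
- near=> x; have x0 : 0 < x by [].
  have [X0 Xe] := curveX_bounds c x0.
  have XM : Num.max (1 - c) 0 <= X x by rewrite ge_max !ltW.
  rewrite XM/= -lerBlDl -(ger0_norm (_ : 0 <= X x - _)) ?subr_ge0//.
  rewrite -sqrtr_sqr ler_wsqrtr// (le_trans (_ : _ <= X x * (X x - (1 - c))))//.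
    rewrite expr2 ler_pM ?subr_ge0//.
      by rewrite lerBlDr lerDl le_max lexx orbT.
    by rewrite lerD2l lerN2 le_max lexx.
  rewrite curveX_mul//; have yp := y0_gt0 c x0.
  have -> : (1 + y x) / y x ^+ 2 = (y x)^-1 ^+ 2 + (y x)^-1.
    by field; rewrite gt_eqF.
  have yi := y0_inv_le x0; rewrite lerD//.
  have -> : x ^+ 2 / 4 = (x / 2) ^+ 2 by field.
  by rewrite ler_pXn2r// nnegrE ?invr_ge0 ?divr_ge0// ltW.
- exact: cvg_cst.
- rewrite -[X in _ --> X]addr0; apply: cvgD; first exact: cvg_cst.
  apply: cvg_sqrt_at_right0; last by rewrite expr0n/= !mul0r addr0.
  move=> x; apply: cvgD; last exact: mulrr_continuous.
  by apply: cvgM; [exact: exprn_continuous|exact: cvg_cst].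
Unshelve. all: by end_near. Qed.

(** For c > 1 both coordinates tend to 0, but X is at most of order 1 / y while T^2 is equivalent to
    1 / y. The arc thus leaves 0 vertically, and the argument of S starts at pi / 2. *)
Lemma cvg_curve_slope_at_right0 : 1 < c -> T x / X x @[x --> 0^'+] --> +oo.
Proof.
move=> c1; apply/cvgryPge => A; near=> x.
have x0 : 0 < x by [].
have [X0 _] := curveX_bounds c x0; have yp := y0_gt0 c x0.
have x2 : x <= 2 by near: x; apply: nbhs_right_le.
(* Chosen so that X (c - 1) <= 2 / y and 1 / y <= x / 2 yield (A^2 + 1) X^2 <= 1 / y. *)
have xA : x <= (c - 1) ^+ 2 / 2 / (A ^+ 2 + 1).
  near: x; apply: nbhs_right_le; rewrite divr_gt0// ?divr_gt0// ?exprn_gt0 ?subr_gt0//.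
  by rewrite ltr_wpDl// sqr_ge0.
have y1 : 1 <= y x.
  rewrite -[leRHS]invrK invf_ge1 ?invr_gt0//.
  by apply: (le_trans (y0_inv_le x0)); lra.
have Xy : X x * (c - 1) <= 2 / y x.
  apply: (@le_trans _ _ (X x * (X x - (1 - c)))).
    by rewrite ler_pM2l//; lra.
  rewrite curveX_mul// ler_pdivrMr ?exprn_gt0//.
  by rewrite expr2 mulrA divfK ?gt_eqF//; lra.
have T2 : A ^+ 2 * X x ^+ 2 <= curveT2 c x.
  rewrite curveT2E// lerBrDl.
  have XX : X x ^+ 2 / (1 + y x) <= X x ^+ 2.
    by rewrite ler_pdivrMr ?addr_gt0// ler_peMr ?sqr_ge0// lerDl ltW.
  apply: (@le_trans _ _ ((A ^+ 2 + 1) * X x ^+ 2)); first by lra.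
  have XX' : X x ^+ 2 * (c - 1) ^+ 2 <= (2 / y x) ^+ 2.
    have X1 : 0 < X x * (c - 1) by rewrite mulr_gt0 ?subr_gt0.
    by rewrite -exprMn ler_pXn2r// nnegrE ltW// divr_gt0.
  have cc : 0 < (c - 1) ^+ 2 by rewrite exprn_gt0// subr_gt0.
  rewrite -(@ler_pM2r _ ((c - 1) ^+ 2))// -mulrA.
  have A1 : 0 < A ^+ 2 + 1 by rewrite ltr_wpDl// sqr_ge0.
  apply: (le_trans (ler_wpM2l (ltW A1) XX')).
  have -> : (2 / y x) ^+ 2 = 4 * (y x)^-1 * (y x)^-1 by field; rewrite gt_eqF.
  rewrite div1r [leRHS]mulrC !mulrA ler_wpM2r ?invr_ge0 ?(ltW yp)//.
  have := y0_inv_le x0; move: xA; rewrite ler_pdivlMr// => xA yi.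
  apply: (@le_trans _ _ ((A ^+ 2 + 1) * (4 * (x / 2)))); last by lra.
  by rewrite -mulrA ler_pM2l// ler_pM2l.
rewrite ler_pdivlMr//; have [A0|A0] := leP 0 A; last first.
  by apply: (le_trans _ (sqrtr_ge0 _)); rewrite mulr_le0_ge0// ltW.
have AX : 0 <= A * X x by rewrite mulr_ge0// ltW.
rewrite -(ger0_norm AX) -sqrtr_sqr.
by rewrite ler_wsqrtr// exprMn.
Unshelve. all: by end_near. Qed.

End curve_at_0.

(** * Increments of the primitive between the ends of the arc *)

Section psi_bound.
Context {R : realType}.
Variables (c s k : R).
Hypotheses (s1 : 1 < s) (k0 : 0 < k) (sk : s ^+ 2 = 1 + k ^+ 2)
  (eE : 1 - c = s * (1 - k ^+ 2)) (dE : d c = s ^+ 2 * k).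
Implicit Types x : R.
Local Notation y := (y0 c).
Local Notation Y := (curveY c).
Local Notation X := (curveX c).
Local Notation T := (curveT c).
Local Notation Qr x := (quadr s k (X x) (T x)).
Local Notation Qi x := (quadi s k (X x) (T x)).

Let s0 : 0 < s. Proof. exact: lt_trans s1. Qed.
Let d0 : 0 < d c. Proof. exact: (edge_gt0 s1 k0 dE). Qed.

Lemma edge_kernel_ge0 x : 0 < x < d c -> 0 <= edge_kernel c x.
Proof.
move=> /andP[x0 xd]; rewrite mulr_ge0// divr_ge0 ?sqrtr_ge0 ?(ltW x0)//.
  by rewrite mulr_ge0// ltW.
by rewrite subr_ge0 ler_pXn2r ?nnegrE// ltW.
Qed.

Section psi.
Variable Th : R -> R -> R.
Hypothesis Th_spec : quad_primitive s k Th.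

(* The part of the primitive that has a limit at both ends of the arc; the
   remaining term of psi, the argument of S - s up to a factor, is only bounded. *)
Definition psi_reg x := 2 * (s ^+ 2 - 2) / (s * k) * atan (T x / X x)
  + (s * k)^-1 * atan (Qi x / Qr x) + Th (X x) (T x).

(** For T > 0 the last bracket is the argument of S - s in ]0, pi[; since X < s on the arc, it is at
    least pi / 2. *)
Definition psi x := psi_reg x - 2 * k / s * (pi / 2 + atan ((s - X x) / T x)).

Lemma is_derive_psi x : 0 < x < d c -> is_derive x 1 psi (edge_kernel c x).
Proof.
move=> xd; have T2 := curveT2_gt0 s1 k0 sk eE dE xd.
case/andP: (xd) => x0 xltd.
have T0 : T x != 0 by rewrite gt_eqF// sqrtr_gt0.
have [X0 _] := curveX_bounds c x0.
have Q0 : 0 < Qr x by apply: quadr_curve_gt0; rewrite // x0 ltW.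
have [_ Th_derive _] := Th_spec.
have DX := is_derive_curveX c x0; have DT := is_derive_curveT x0 T2.
have K := edge_kernel_arg s1 k0 sk eE dE xd.
set dX := (_ / 2 : R) in DX; rewrite -/dX in K.
set dT := (_ / (2 * T x)) in DT; rewrite -/dT in K.
have D1 := is_derive_arg DX DT (lt0r_neq0 X0).
have DsX : is_derive x 1 (fun t => s - X t) (- dX).
  by apply: is_derive_eq; rewrite /GRing.scale/=; ring.
have D2 := is_derive_arg DT DsX T0.
have DTh := Th_derive _ _ _ _ _ X0 DX DT.
have Dr : is_derive x 1 (fun t => Qr t) (2 * X x * dX - 2 * T x * dT + 2 * s * k ^+ 2 * dX).
  rewrite /quadr.
  by apply: is_derive_eq; rewrite /GRing.scale/=; ring.
have Di : is_derive x 1 (fun t => Qi t) (dT * (2 * X x + 2 * s * k ^+ 2) + T x * (2 * dX)).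
  rewrite /quadi.
  by apply: is_derive_eq; rewrite /GRing.scale/=; ring.
have D3 := is_derive_arg Dr Di (lt0r_neq0 Q0).
rewrite -K /psi /psi_reg; apply: is_derive_eq; rewrite /GRing.scale/=.
have -> : im_quot dT (- dX) (T x) (s - X x) = im_quot dX dT (X x - s) (T x).
  by rewrite /im_quot; congr (_ / _); ring.
by ring.
Qed.

Lemma psi_nondecreasing x x' : 0 < x -> x <= x' -> x' < d c -> psi x <= psi x'.
Proof.
move=> x0; rewrite le_eqVlt => /predU1P[->//|xx' x'd].
have I z : x <= z <= x' -> 0 < z < d c.
  by move=> /andP[xz zx']; rewrite (lt_le_trans x0 xz) (le_lt_trans zx' x'd).
have [||z zI] := @MVT _ psi (edge_kernel c) x x' xx'.
- by move=> z; rewrite in_itv/= => /andP[xz zx']; apply/is_derive_psi/I; rewrite !ltW.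
- apply: derivable_within_continuous => z; rewrite in_itv/= => /I zd.
  by have [] := is_derive_psi zd.
rewrite -subr_ge0 => ->; rewrite mulr_ge0 ?subr_ge0 ?(ltW xx')//.
apply: edge_kernel_ge0; apply: I; move: zI; rewrite in_itv/= => /andP[? ?].
by rewrite !ltW.
Qed.

Lemma atan_edge_bounds x : 0 < x < d c -> 0 <= atan ((s - X x) / T x) <= pi / 2.
Proof.
move=> xd; rewrite (ltW (atan_ltpi2 _)) andbT -atan0 le_atan// divr_ge0 ?sqrtr_ge0//.
by rewrite subr_ge0 ltW// (curveX_lt_edge s1 k0 sk eE dE).
Qed.

Lemma cvg_psi_reg (F : set_system R) (FF : Filter F) (a l : R) : 0 <= a ->
  X @ F --> a -> T @ F --> (0 : R) -> 
  (fun x => 2 * (s ^+ 2 - 2) / (s * k) * atan (T x / X x)) @ F --> l ->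
  psi_reg @ F --> l.
Proof.
move=> a0 Xa T0 Al; have [_ _ Th_cvg] := Th_spec.
rewrite -[X in _ --> X]addr0 -[X in _ --> X]addr0; apply: cvgD; last exact: Th_cvg Xa T0.
apply: cvgD => //.
rewrite -[X in _ --> X](mulr0 (s * k)^-1); apply: cvgM; first exact: cvg_cst.
apply: (@cvg_arg _ _ _ _ _ _ (quadr s k a 0)); last 2 first.
- rewrite -(mul0r (2 * a + 2 * s * k ^+ 2)); apply: cvgM => //.
  by apply: cvgD; [apply: cvgM => //|]; exact: cvg_cst.
- rewrite gt_eqF// /quadr expr0n/= subr0 ltr_wpDl//.
    by rewrite addr_ge0 ?sqr_ge0// !mulr_ge0// ltW// exprn_gt0.
  by rewrite mulr_gt0// exprn_gt0.
rewrite /quadr; apply: cvgD; last exact: cvg_cst.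
apply: cvgD; last by apply: cvgM => //; exact: cvg_cst.
by apply: cvgB; exact: cvg_sqr.
Qed.

Lemma cvg_psi_reg_edge : psi_reg x @[x --> (d c)^'-] --> 0.
Proof.
have cX : X x @[x --> (d c)^'-] --> s.
  rewrite -(curveX_edge s1 k0 sk eE dE); apply: cvg_at_left_filter.
  apply/differentiable_continuous/derivable1_diffP.
  by have [] := is_derive_curveX c d0.
have cT : T x @[x --> (d c)^'-] --> 0.
  rewrite -(curveT_edge s1 k0 sk eE dE); apply: cvg_at_left_filter.
  apply: (@continuous_comp _ _ _ (curveT2 c) (@Num.sqrt R)).
    apply/differentiable_continuous/derivable1_diffP.
    by have [] := is_derive_curveT2 c d0.
  exact: sqrt_continuous.
apply: (cvg_psi_reg _ _ cX cT _); first exact: ltW.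
rewrite -[X in _ --> X](mulr0 (2 * (s ^+ 2 - 2) / (s * k))).
by apply: cvgM; [exact: cvg_cst|apply: (cvg_arg cX cT _); rewrite gt_eqF].
Qed.

(** At x = 0 the argument of S is the one possible contribution: it tends to 0 if c < 1 and to pi /
    2 if c > 1. For c = 1 its coefficient vanishes because s (s^2 - 2) = c - 1, which spares the
    limit of T / X. *)
Lemma cvg_psi_reg0 : psi_reg x @[x --> 0^'+] --> pi * (Num.max 0 (c - 1) / d c).
Proof.
have H : s * (s ^+ 2 - 2) = c - 1.
  by rewrite -(opprB 1 c) eE sk; ring.
have cX := @cvg_curveX_at_right0 R c; have cT := @cvg_curveT_at_right0 R c.
have M0 : 0 <= Num.max (1 - c) 0 by rewrite le_max lexx orbT.
have [c1|c1|c1] := ltgtP c 1.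
- rewrite max_l ?subr_le0 ?ltW// mul0r mulr0.
  apply: (cvg_psi_reg _ _ cX cT _) => //.
  rewrite -[X in _ --> X](mulr0 (2 * (s ^+ 2 - 2) / (s * k))).
  apply: cvgM; [exact: cvg_cst|apply: (cvg_arg cX cT _)].
  by rewrite gt_eqF// lt_max subr_gt0 c1.
- rewrite max_r ?subr_ge0 ?ltW//.
  have -> : pi * ((c - 1) / d c) = 2 * (s ^+ 2 - 2) / (s * k) * (pi / 2).
    by rewrite -H dE; move: (@pi R) => p; field; rewrite !gt_eqF.
  apply: (cvg_psi_reg _ _ cX cT _) => //.
  apply: cvgM; first exact: cvg_cst.
  exact: (cvg_comp _ _ (cvg_curve_slope_at_right0 c1) (@cvgy_atan R)).
- rewrite c1 subrr maxxx mul0r mulr0; rewrite c1 in cX cT M0.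
  have s20 : s ^+ 2 - 2 = 0.
    apply/eqP; move: H; rewrite c1 subrr => /eqP.
    by rewrite mulf_eq0 gt_eqF.
  rewrite -c1 in cX cT M0; apply: (cvg_psi_reg _ _ cX cT _) => //.
  rewrite s20 mulr0 mul0r; under eq_fun do rewrite mul0r.
  exact: cvg_cst.
Qed.

(** As psi is nondecreasing, it is compared with its behaviour at the two ends. Bounding the
    argument of S - s below by pi / 2 near d and above by pi near 0 gives the term (2 k / s) (pi -
    pi / 2). *)
Lemma psi_diff_le x x' : 0 < x -> x <= x' -> x' < d c ->
  psi x' - psi x <= pi * (k / s - Num.max 0 (c - 1) / d c).
Proof.
move=> x0 xx' x'd.
have pk : 0 <= 2 * k / s by rewrite divr_ge0 ?mulr_ge0// ltW.
have U : psi x' <= 0 - 2 * k / s * (pi / 2).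
  apply: (@cvgr_to_ge _ _ _ _ (fun z => psi_reg z - 2 * k / s * (pi / 2)) _ _
    (cvgB cvg_psi_reg_edge (cvg_cst _))).
  near=> z; have zd : z < d c by [].
  have xz : x' <= z by near: z; apply: nbhs_left_ge.
  have z0 : 0 < z by rewrite (lt_le_trans x0)// (le_trans xx').
  apply: (le_trans (psi_nondecreasing _ xz zd)); first exact: lt_le_trans xx'.
  rewrite /psi lerD2l lerN2 ler_wpM2l// lerDl.
  by have /andP[] : 0 <= atan ((s - X z) / T z) <= pi / 2;
    first by rewrite atan_edge_bounds// z0.
have L : pi * (Num.max 0 (c - 1) / d c) - 2 * k / s * pi <= psi x.
  apply: (@cvgr_to_le _ _ _ _ (fun z => psi_reg z - 2 * k / s * pi) _ _
    (cvgB cvg_psi_reg0 (cvg_cst _))).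
  near=> z; have z0 : 0 < z by [].
  have zx : z <= x by near: z; apply: nbhs_right_le.
  have zd : z < d c by rewrite (le_lt_trans zx)// (le_lt_trans xx').
  apply: (le_trans _ (psi_nondecreasing z0 zx _)); last exact: le_lt_trans x'd.
  rewrite /psi lerD2l lerN2 ler_wpM2l//.
  have /andP[_] : 0 <= atan ((s - X z) / T z) <= pi / 2.
    by rewrite atan_edge_bounds// z0.
  by lra.
apply: (le_trans (lerB U L)); rewrite le_eqVlt; apply/orP; left; apply/eqP.
by move: (@pi R) (Num.max 0 (c - 1) / d c) => p m; field; rewrite gt_eqF.
Unshelve. all: by end_near. Qed.

End psi.

End psi_bound.

(** * The integral of the kernel *)

Section density.
Context {R : realType}.
Local Notation mu := (@lebesgue_measure R).
Variables (nu : {measure set R -> \bar R}) (p : R -> R).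
Hypotheses (mp : measurable_fun [set: R] p) (p0 : forall x, 0 <= p x)
  (nuE : forall A, measurable A -> nu A = (\int[mu]_(x in A) (p x)%:E)%E).
Local Open Scope ereal_scope.

Let integral_density_indic (E : set R) : measurable E ->
  \int[nu]_x (\1_E x)%:E = \int[mu]_x ((\1_E x)%:E * (p x)%:E).
Proof.
move=> mE; rewrite integral_indic//= setIT nuE// integral_mkcond.
apply: eq_integral => x _; rewrite patchE indicE.
by case: ifPn => xE; rewrite ?mul1e ?mul0e.
Qed.

Import HBNNSimple.

Let integral_density_nnsfun (f : {nnsfun R >-> R}) :
  \int[nu]_x (f x)%:E = \int[mu]_x ((f x)%:E * (p x)%:E).
Proof.
have mi r : measurable_fun [set: R] (fun x => (r * \1_(f @^-1` [set r]) x)%R).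
  exact: measurableT_comp.
have mi1 r : measurable_fun [set: R] (\1_(f @^-1` [set r]) : R -> R).
  by [].
under [LHS]eq_integral do rewrite fimfunE -fsumEFin//.
rewrite [LHS]ge0_integral_fsum//; last 2 first.
  - by move=> r; exact/measurable_EFinP/measurableT_comp.
  - by move=> n x _; rewrite EFinM nnfun_muleindic_ge0.
under [RHS]eq_integral.
  move=> x xD; rewrite fimfunE -fsumEFin// ge0_mule_fsuml; last first.
    by move=> r; rewrite EFinM nnfun_muleindic_ge0.
  over.
rewrite [RHS]ge0_integral_fsum//; last 2 first.
  - move=> r; apply: emeasurable_funM; last exact/measurable_EFinP.
    apply/measurable_EFinP; exact: mi.
  - move=> n x _; rewrite EFinM; apply: mule_ge0; last by rewrite lee_fin.
    exact: nnfun_muleindic_ge0.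
apply: eq_fsbigr => r _.
rewrite integralZl_indic_nnsfun//= integral_density_indic//.
have [r0|r0] := leP 0%R r.
  rewrite -ge0_integralZl//.
  - by apply: eq_integral => x _; rewrite EFinM muleA.
  - apply: emeasurable_funM; last exact/measurable_EFinP.
    by apply/measurable_EFinP; exact: mi1.
  - by move=> x _; rewrite mule_ge0// ?lee_fin.
rewrite preimage_nnfun0// [in LHS]integral0_eq; last first.
  by move=> x _; rewrite indicE in_set0 mul0e.
rewrite mule0 integral0_eq// => x _.
by rewrite indicE in_set0 mulr0 mul0e.
Qed.

(** Indicators first, then simple functions, then monotone convergence along [nnsfun_approx]. *)
Lemma ge0_integral_density (f : R -> \bar R) :
  measurable_fun setT f -> (forall x, 0 <= f x) ->
  \int[nu]_x f x = \int[mu]_x (f x * (p x)%:E).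
Proof.
move=> mf f0.
pose f_ := nnsfun_approx measurableT mf.
have mf_ n : measurable_fun [set: R] (f_ n) by [].
have ndf_ (x : R) m n : (m <= n)%N -> (f_ m x <= f_ n x)%R.
  by move=> mn; exact/lefP/nd_nnsfun_approx.
transitivity (lim (\int[nu]_x (f_ n x)%:E @[n --> \oo])).
  rewrite -monotone_convergence//=.
  - apply: eq_integral => ? /[!inE] xD; apply/esym/cvg_lim => //=.
    exact: cvg_nnsfun_approx.
  - by move=> n; exact/measurable_EFinP/measurable_funTS.
  - by move=> n ? _; rewrite lee_fin.
  - by move=> ? _ ? ? mn; rewrite lee_fin; exact/lefP/nd_nnsfun_approx.
transitivity (lim (\int[mu]_x ((f_ n x)%:E * (p x)%:E) @[n --> \oo])).
  by apply: congr_lim; apply/funext => n /=; exact: integral_density_nnsfun.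
rewrite -monotone_convergence//=.
- apply: eq_integral => x _; apply/cvg_lim => //.
  have fx : (f_ n x)%:E @[n --> \oo] --> f x by exact: cvg_nnsfun_approx.
  exact: cvgeZr.
- move=> n; apply: emeasurable_funM; last exact/measurable_EFinP.
  by apply/measurable_EFinP; exact: mf_.
- by move=> n x _; rewrite mule_ge0// ?lee_fin.
- move=> x _ m n mn; rewrite lee_wpmul2r// lee_fin//.
  exact: ndf_.
Qed.

End density.

Lemma ge0_integral_lebesgueN (R : realType) (f : R -> \bar R) :
  measurable_fun [set: R] f -> (forall x, (0 <= f x)%E) ->
  (\int[lebesgue_measure]_x f (- x)%R = \int[lebesgue_measure]_x f x)%E.
Proof.
move=> mf f0.
rewrite -[X in integral _ X _](preimage_setT (-%R : _ -> measurableTypeR R)).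
rewrite -ge0_integral_pushforward//=.
by apply: eq_measure_integral => //= A mA _; exact: lebesgue_measureN.
Qed.

Section edge_integral.
Context {R : realType}.
Variables (c s k : R).
Hypotheses (c0 : 0 < c) (s1 : 1 < s) (k0 : 0 < k) (sk : s ^+ 2 = 1 + k ^+ 2)
  (eE : 1 - c = s * (1 - k ^+ 2)) (dE : d c = s ^+ 2 * k).
Local Notation mu := (@lebesgue_measure R).

Let d0 : 0 < d c. Proof. exact: (edge_gt0 s1 k0 dE). Qed.

Lemma continuous_edge_kernel x : 0 < x < d c ->
  {for x, continuous (edge_kernel c)}.
Proof.
move=> /[dup] xd /andP[x0 xltd].
have T2 := curveT2_gt0 s1 k0 sk eE dE xd.
have DT := is_derive_curveT x0 T2.
apply: cvgM; first apply: cvgM.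
- by apply/differentiable_continuous/derivable1_diffP; case: DT.
- by apply: cvgV; [rewrite gt_eqF|exact: cvg_id].
apply: cvgM; first exact: cvg_cst.
apply: cvgV.
  by rewrite subr_eq0 eq_sym lt_eqF// ltrXn2r// ltW.
by apply: cvgB; [exact: cvg_cst|exact: exprn_continuous].
Qed.

Lemma integral_edge_kernel_itv_le a b : 0 < a -> a < b -> b < d c ->
  (\int[mu]_(x in `[a, b]) (edge_kernel c x)%:E
   <= (pi * (k / s - Num.max 0 (c - 1) / d c))%:E)%E.
Proof.
move=> a0 ab bd; have [Th ThP] := quad_primitive_ex (lt_trans ltr01 s1) k0.
have I z : a <= z <= b -> 0 < z < d c.
  by move=> /andP[az zb]; rewrite (lt_le_trans a0 az) (le_lt_trans zb bd).
have Dpsi z : a <= z <= b -> derivable (psi c s k Th) z 1.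
  by move=> /I zd; case: (is_derive_psi s1 k0 sk eE dE ThP zd).
have Cpsi z : a <= z <= b -> {for z, continuous (psi c s k Th)}.
  by move=> zab; apply/differentiable_continuous/derivable1_diffP/Dpsi.
rewrite (@continuous_FTC2 _ _ (psi c s k Th))//.
- by rewrite -EFinB lee_fin (psi_diff_le s1 k0 sk eE dE ThP)// ltW.
- apply: continuous_in_subspaceT => z; rewrite inE/= in_itv/= => /I.
  exact: continuous_edge_kernel.
- split.
  + by move=> z; rewrite in_itv/= => /andP[az zb]; apply: Dpsi; rewrite !ltW.
  + by apply: cvg_at_right_filter; apply: Cpsi; rewrite lexx ltW.
  + by apply: cvg_at_left_filter; apply: Cpsi; rewrite lexx ltW.
move=> z; rewrite in_itv/= => /andP[az zb].
have zd : 0 < z < d c by apply: I; rewrite !ltW.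
by rewrite derive1E; case: (is_derive_psi s1 k0 sk eE dE ThP zd).
Qed.

Lemma integral_edge_kernel_le :
  (\int[mu]_(x in `]0%R, d c[) (edge_kernel c x)%:E
   <= (pi * (k / s - Num.max 0 (c - 1) / d c))%:E)%E.
Proof.
(* Exhaustion of ]0, d[ by compact intervals, on which psi is continuous; starting the denominators
   at 3 keeps every interval nondegenerate. *)
pose e (n : nat) : R := d c / n.+3%:R.
have e0 n : 0 < e n by rewrite divr_gt0.
have e3 n : e n <= d c / 3 by rewrite ler_pM2l// lef_pV2 ?posrE// ler_nat.
pose F (n : nat) := `[e n, d c - e n]%classic.
have FE : `]0, d c[%classic = \bigcup_n F n.
  apply/seteqP; split=> x; rewrite /= in_itv/=.
    move=> /andP[x0 xd].
    have m0 : 0 < Num.min x (d c - x) / d c.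
      by rewrite divr_gt0// lt_min x0 subr_gt0.
    have [n _ nm] := near_infty_natSinv_lt (PosNum m0).
    exists n => //; rewrite /F/= in_itv/=.
    have en : e n <= Num.min x (d c - x).
      have := nm n.+2 (leq_trans (leqnSn _) (leqnSn _)).
      by rewrite ltr_pdivlMr// mulrC => /ltW.
    move: en; rewrite le_min => /andP[-> en]/=; lra.
  by move=> [n _]; rewrite /F/= in_itv/= => /andP[ex xe]; have := e0 n; lra.
rewrite FE.
have cvgF : (\int[mu]_(x in F n) (edge_kernel c x)%:E)%E @[n --> \oo] -->
    (\int[mu]_(x in \bigcup_n F n) (edge_kernel c x)%:E)%E.
  have FI n x : F n x -> 0 < x < d c.
    by rewrite /F/= in_itv/= => /andP[ex xe]; have := e0 n; lra.
  apply: ge0_nondecreasing_set_cvg_integral.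
  - apply/nondecreasing_seqP => n; rewrite subsetEset => x.
    rewrite /F/= !in_itv/= => /andP[ex xe].
    have : e n.+1 <= e n by rewrite ler_pM2l// lef_pV2 ?posrE// ler_nat.
    by lra.
  - by move=> n; exact: measurable_itv.
  - move=> n; apply/measurable_EFinP; apply: subspace_continuous_measurable_fun.
      exact: measurable_itv.
    apply: continuous_in_subspaceT => x; rewrite inE => /FI.
    exact: continuous_edge_kernel.
  - by move=> n x /FI xd; rewrite lee_fin (edge_kernel_ge0 s1 k0 dE).
apply: (@cvge_to_le _ _ _ _ _ _ _ cvgF); apply: nearW => n.
apply: integral_edge_kernel_itv_le => //.
- by have := e3 n; have := d0; lra.
- by have := e0 n; lra.
Unshelve. all: by end_near. Qed.

End edge_integral.

(** * The Stieltjes transform outside the support *)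

Section integral_Fc.
Context {R : realType}.
Variables (c : R) (c0 : 0 < c).
Local Notation mu := (@lebesgue_measure R).
Local Notation D := `[- d c, d c]%classic.
Local Notation atom := (Num.max 0 (1 - 1 / c)).

Let in_D x : D x <-> `|x| <= d c.
Proof. by rewrite /= in_itv/= ler_norml. Qed.

Lemma phi_out x : ~ D x -> phi c x = 0.
Proof. by move=> Dx; rewrite /phi; case: ifPn => // /in_D. Qed.

Lemma d_gt0 : 0 < d c.
Proof.
by have [s [k [s1 k0 _ _ dE]]] := edge_parametrization c0; exact: edge_gt0 dE.
Qed.

Lemma Fc_out : Fc c0 (~` D) = 0%E.
Proof.
rewrite [LHS](@measure_addE _ _ _ _ _ (~` D)) -[RHS]add0e; congr (_ + _)%E.
  by apply: integral0_eq => x Dx; rewrite phi_out.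
have H : \d_(0 : R) (~` D) = 0%E :> \bar R.
  by rewrite diracE memNset//; apply; rewrite in_D normr0 ltW// d_gt0.
by apply/eqP; rewrite mule_eq0; apply/orP; right; apply/eqP; exact: H.
Qed.

(** The complement of [- d, d] is null. On [- d, d] the function 1 / (x - l) has a constant sign for
    l outside, which opens the way to the lemmas on nonnegative integrands. *)
Lemma integral_FcE (f : R -> \bar R) : measurable_fun [set: R] f ->
  (\int[Fc c0]_x f x = \int[Fc c0]_(x in D) f x)%E.
Proof.
move=> mf; rewrite [RHS]integral_mkcond.
have mD : measurable (D : set R) by exact: measurable_itv.
apply: ae_eq_integral => //.
  by apply/(measurable_restrictT f) => //; exact: measurable_funTS.
exists (~` D); split; [exact: measurableC|exact: Fc_out|].
by move=> x /= + Dx; apply => _; rewrite patchE mem_set.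
Qed.

Lemma ge0_integral_Fc (f : R -> R) : measurable_fun [set: R] f ->
  (forall x, D x -> 0 <= f x) ->
  (\int[Fc c0]_(x in D) (f x)%:E =
   \int[mu]_x (phi c x * f x)%:E + (atom * f 0)%:E)%E.
Proof.
move=> mf f0; have mD : measurable (D : set R) by exact: measurable_itv.
have mfE : measurable_fun D (EFin \o f).
  by apply/measurable_funTS/measurable_EFinP.
rewrite /Fc ge0_integral_measure_add//=; congr (_ + _)%E.
  rewrite integral_mkcond.
  apply: (etrans (@ge0_integral_density R
    (Defs_Fc_ac__canonical__measure_function_Measure c0) (phi c) _ _ _
    ((fun x : R => (f x)%:E) \_ D) _ _)).
  - exact: measurable_phi.
  - by move=> x; exact: phi_ge0.
  - by [].
  - exact/(measurable_restrictT (EFin \o f)).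
  - by move=> x; rewrite patchE; case: ifPn => // /set_mem/f0; rewrite lee_fin.
  apply: eq_integral => x _; rewrite patchE; case: ifPn => xD.
    by rewrite -EFinM mulrC.
  by rewrite mul0e phi_out ?mul0r// => Dx; move: xD; rewrite mem_set.
rewrite ge0_integral_mscale//= integral_dirac// diracE mem_set ?mul1e//.
by rewrite in_D normr0 ltW// d_gt0.
Qed.

End integral_Fc.

Lemma measurable_invr (R : realType) : measurable_fun [set: R] (fun x => x^-1).
Proof.
have n0 : measurable (~` [set 0 : R]) by apply: measurableC.
rewrite -(setvU [set 0 : R]); apply/measurable_funU => //.
split; last exact: measurable_fun_set1.
apply: open_continuous_measurable_fun.
  by rewrite openC; exact: closed_eq.
by move=> x; rewrite inE/= => /eqP x0; apply: inv_continuous.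
Qed.

Section ac_stieltjes.
Context {R : realType}.
Variables (c : R) (c0 : 0 < c).
Local Notation mu := (@lebesgue_measure R).
Local Notation D := `[- d c, d c]%classic.
Local Notation atom := (Num.max 0 (1 - 1 / c)).
Implicit Types l x : R.

(** Minus the Stieltjes transform of the absolutely continuous part, a nonnegative quantity for l >
    d; finiteness is [ac_stieltjesE]. *)
Definition ac_stieltjes l : R := fine (\int[mu]_x (phi c x / (l - x))%:E)%E.

Lemma ac_integrand_ge0 l x : d c < l -> 0 <= phi c x / (l - x).
Proof.
move=> dl; have [xd|xd] := boolP (`|x| <= d c); last first.
  by rewrite /phi (negbTE xd) mul0r.
rewrite divr_ge0 ?phi_ge0// subr_ge0 (le_trans (ler_norm x))//.
by rewrite (le_trans xd)// ltW.
Qed.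

Lemma measurable_ac_integrand l :
  measurable_fun [set: R] (fun x => phi c x / (l - x)).
Proof.
apply: measurable_funM; first exact: measurable_phi.
by apply: (measurableT_comp (@measurable_invr R)); exact: measurable_funB.
Qed.

Lemma measurable_ac_integrandN l :
  measurable_fun [set: R] (fun x => phi c x / (l + x)).
Proof.
apply: measurable_funM; first exact: measurable_phi.
by apply: (measurableT_comp (@measurable_invr R)); exact: measurable_funD.
Qed.

Lemma ac_integrandN l x : phi c (- x) / (l - - x) = phi c x / (l + x).
Proof. by rewrite -phi_normr normrN phi_normr opprK. Qed.

Lemma ac_integrandN_ge0 l x : d c < l -> 0 <= phi c x / (l + x).
Proof. by move=> dl; rewrite -ac_integrandN ac_integrand_ge0. Qed.

Lemma measurable_sym_integrand l : d c < l ->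
  measurable_fun `]0, d c[ (fun x => phi c x * (2 * l / (l ^+ 2 - x ^+ 2))).
Proof.
move=> dl; apply: (eq_measurable_fun
    (fun x => phi c x / (l - x) + phi c x / (l + x))).
  move=> x; rewrite inE/= in_itv/= => /andP[x0 xd]; field.
  have : x < l by exact: lt_trans dl.
  by move=> xl; rewrite !gt_eqF ?subr_gt0// ?addr_gt0//; nra.
apply: measurable_funTS; apply: measurable_funD.
  exact: measurable_ac_integrand.
exact: measurable_ac_integrandN.
Qed.

(** The density is even, so folding the negative half-line onto the positive one replaces 1 / (l -
    x) by 1 / (l - x) + 1 / (l + x). *)
Lemma ac_integral_le_sym l : d c < l ->
  (\int[mu]_x (phi c x / (l - x))%:E
   <= \int[mu]_(x in `]0%R, d c[) (phi c x * (2 * l / (l ^+ 2 - x ^+ 2)))%:E)%E.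
Proof.
move=> dl; have dg := d_gt0 c0.
have m1 := measurable_ac_integrand l; have m2 := measurable_ac_integrandN l.
have mpos : measurable (`[0, +oo[ : set R) by exact: measurable_itv.
have split0 : [set: R] = `[0, +oo[ `|` `]-oo, 0[.
  by apply/seteqP; split => x //= _; rewrite !in_itv/= andbT; case: (leP 0 x); [left|right].
rewrite [leLHS](_ : _ = \int[mu]_(x in `[0%R, +oo[ `|` `]-oo, 0%R[)
  (phi c x / (l - x))%:E)%E; last by rewrite -split0.
rewrite ge0_integral_setU//=; last 3 first.
- by rewrite -split0; exact/measurable_EFinP.
- by move=> x _; rewrite lee_fin ac_integrand_ge0.
- rewrite disj_set2E; apply/eqP; rewrite -subset0 => x []/=.
  by rewrite !in_itv/= andbT leNgt => /negP.
rewrite integral_itv_bndo_bndc; last first.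
  by apply/measurable_funTS/measurable_EFinP.
have subst : (\int[mu]_(x in `]-oo, 0%R]) (phi c x / (l - x))%:E =
    \int[mu]_(x in `[0%R, +oo[) (phi c x / (l + x))%:E)%E.
  rewrite [RHS]ge0_integration_by_substitution0.
  - by apply: eq_integral => x _; rewrite -ac_integrandN opprK.
  - exact/measurable_EFinP.
  - by move=> x; rewrite lee_fin ac_integrandN_ge0.
rewrite subst -ge0_integralD//; last 4 first.
- by move=> x _; rewrite lee_fin ac_integrand_ge0.
- by apply/measurable_funTS/measurable_EFinP.
- by move=> x _; rewrite lee_fin ac_integrandN_ge0.
- by apply/measurable_funTS/measurable_EFinP.
rewrite -(@integral_itv_bndoo _ _ _ _ true false); last first.
  by apply/measurable_EFinP; exact: measurable_sym_integrand.
rewrite integral_mkcond [leRHS]integral_mkcond le_eqVlt; apply/orP; left.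
apply/eqP; apply: eq_integral => x _; rewrite !patchE !mem_setE.
rewrite !in_itv/= andbT; have [x0|x0]/= := leP 0 x => //.
have [xd|xd] := leP x (d c).
  have xl : x < l by exact: le_lt_trans dl.
  have lx : l ^+ 2 - x ^+ 2 != 0.
    by rewrite gt_eqF// subr_gt0 ltrXn2r// (le_trans _ (ltW xl)).
  have l1 : l - x != 0 by rewrite gt_eqF// subr_gt0.
  have l2 : l + x != 0 by rewrite gt_eqF// ltr_wpDr// (le_lt_trans x0).
  by rewrite -EFinD; congr EFin; field; do ?[apply/andP; split].
by rewrite phi_out ?mul0r ?adde0// /= in_itv/= => /andP[_]; rewrite leNgt xd.
Qed.

(** For 0 < x < d the factor 2 l / (l^2 - x^2) decreases in l, hence is at most its value at l = d;
    the integrand is then (c pi)^-1 times [edge_kernel]. *)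
Lemma ac_integral_le l : d c < l -> exists s k : R,
  [/\ 1 < s, 0 < k, s ^+ 2 = 1 + k ^+ 2 &
  (\int[mu]_x (phi c x / (l - x))%:E
   <= (c^-1 * (k / s - Num.max 0 (c - 1) / d c))%:E)%E].
Proof.
move=> dl; have dg := d_gt0 c0.
have [s [k [s1 k0 sk eE dE]]] := edge_parametrization c0.
exists s, k; split=> //.
apply: (le_trans (ac_integral_le_sym dl)).
have md : measurable (`]0, d c[ : set R) by exact: measurable_itv.
have mK : measurable_fun `]0, d c[ (edge_kernel c).
  apply: subspace_continuous_measurable_fun => //.
  apply: continuous_in_subspaceT => x; rewrite inE/= in_itv/=.
  exact: continuous_edge_kernel s1 k0 sk eE dE _.
apply: (@le_trans _ _ (\int[mu]_(x in `]0%R, d c[) ((c * pi)^-1%:E * (edge_kernel c x)%:E))%E).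
  apply: ge0_le_integral => //.
  - move=> x /=; rewrite in_itv/= => /andP[x0 xd]; rewrite lee_fin.
    rewrite mulr_ge0 ?phi_ge0// divr_ge0 ?mulr_ge0//; first by rewrite ltW// (lt_trans dg).
    by rewrite subr_ge0 lerXn2r ?nnegrE// ltW// ?(lt_trans xd)// (lt_trans dg).
  - by apply/measurable_EFinP; exact: measurable_sym_integrand.
  - by apply/measurable_EFinP; exact: measurable_funM.
  move=> x /=; rewrite in_itv/= => /[dup] xd /andP[x0 xltd]; rewrite -EFinM lee_fin.
  rewrite (phiE c0 x0 (ltW xltd)); last by rewrite ltW// (curveT2_gt0 s1 k0 sk eE dE xd).
  rewrite /edge_kernel -[leLHS]mulrA; apply: ler_wpM2l.
    by rewrite invr_ge0 mulr_ge0// ?pi_ge0// ltW.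
  apply: ler_wpM2l; first by rewrite divr_ge0 ?sqrtr_ge0// ltW.
  have l0 : 0 < l by exact: lt_trans dl.
  have dx : 0 < d c ^+ 2 - x ^+ 2 by rewrite subr_gt0 ltrXn2r// ltW.
  have lx : 0 < l ^+ 2 - x ^+ 2.
    by rewrite subr_gt0 ltrXn2r// ?(ltW x0)// ?(ltW l0)// (lt_trans xltd).
  rewrite ler_pdivrMr// mulrAC ler_pdivlMr// -subr_ge0.
  have -> : 2 * d c * (l ^+ 2 - x ^+ 2) - 2 * l * (d c ^+ 2 - x ^+ 2) =
     2 * (l - d c) * (l * d c + x ^+ 2) by ring.
  rewrite mulr_ge0// ?mulr_ge0// ?subr_ge0 ?(ltW dl)//.
  by rewrite addr_ge0 ?sqr_ge0// mulr_ge0// ltW.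
rewrite ge0_integralZl_EFin//; last 3 first.
- by move=> x /=; rewrite in_itv/= => xd; rewrite lee_fin (edge_kernel_ge0 s1 k0 dE).
- exact/measurable_EFinP.
- by rewrite invr_ge0 mulr_ge0 ?pi_ge0// ltW.
apply: (le_trans (lee_wpmul2l _ (integral_edge_kernel_le s1 k0 sk eE dE))).
  by rewrite lee_fin invr_ge0 mulr_ge0 ?pi_ge0// ltW.
rewrite -EFinM lee_fin le_eqVlt; apply/orP; left; apply/eqP.
move: (@pi R) (pi_gt0 R) (Num.max 0 (c - 1)) => p p0 m.
have s0 : 0 < s by exact: lt_trans s1.
by field; rewrite !gt_eqF.
Qed.

End ac_stieltjes.

Section neg_stieltjes.
Context {R : realType}.
Variables (c : R) (c0 : 0 < c).
Local Notation mu := (@lebesgue_measure R).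
Local Notation D := `[- d c, d c]%classic.
Local Notation atom := (Num.max 0 (1 - 1 / c)).
Implicit Types l x : R.

Definition neg_stieltjes l : R := ac_stieltjes c l + atom / l.

Lemma ac_stieltjesE l : d c < l ->
  (\int[mu]_x (phi c x / (l - x))%:E = (ac_stieltjes c l)%:E)%E.
Proof.
move=> dl; have [s [k [_ _ _ h]]] := ac_integral_le c0 dl.
rewrite /ac_stieltjes fineK// ge0_fin_numE.
  exact: le_lt_trans h (ltry _).
by apply: integral_ge0 => x _; rewrite lee_fin ac_integrand_ge0.
Qed.

Lemma ac_stieltjes_ge0 l : d c < l -> 0 <= ac_stieltjes c l.
Proof.
move=> dl; rewrite -lee_fin -ac_stieltjesE//.
by apply: integral_ge0 => x _; rewrite lee_fin ac_integrand_ge0.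
Qed.

Lemma atom_ge0 : 0 <= atom.
Proof. by rewrite le_max lexx. Qed.

Lemma neg_stieltjes_ge0 l : d c < l -> 0 <= neg_stieltjes l.
Proof.
move=> dl; rewrite addr_ge0 ?ac_stieltjes_ge0// divr_ge0 ?atom_ge0//.
by rewrite ltW// (lt_trans (d_gt0 c0)).
Qed.

(** The atom contributes max (0, c - 1) / l, at most the term max (0, c - 1) / d subtracted in
    [ac_integral_le]. What remains is k / s, less than 1 because s^2 = 1 + k^2. *)
Lemma neg_stieltjes_lt1 l : d c < l -> c * neg_stieltjes l < 1.
Proof.
move=> dl; have dg := d_gt0 c0.
have [s [k [s1 k0 sk]]] := ac_integral_le c0 dl.
rewrite ac_stieltjesE// lee_fin => h.
have s0 : 0 < s by exact: lt_trans s1.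
have ks : k / s < 1.
  by rewrite ltr_pdivrMr// mul1r -(@ltr_pXn2r _ 2) ?nnegrE ?ltW// sk; lra.
have catom : c * atom = Num.max 0 (c - 1).
  by rewrite maxr_pMr ?(ltW c0)// mulr0 mulrBr mulr1 mul1r divff ?gt_eqF.
have m0 : 0 <= Num.max 0 (c - 1) by rewrite le_max lexx.
have h1 : c * ac_stieltjes c l <= k / s - Num.max 0 (c - 1) / d c.
  by rewrite -(@ler_pM2l _ c^-1) ?invr_gt0// mulrA mulVf ?gt_eqF// mul1r.
have h2 : c * (atom / l) <= Num.max 0 (c - 1) / d c.
  rewrite mulrA catom ler_wpM2l// lef_pV2 ?posrE ?ltW//.
  by rewrite (lt_trans dg).
by rewrite /neg_stieltjes mulrDr; lra.
Qed.

Lemma ac_stieltjes_nonincreasing l l' : d c < l -> l <= l' ->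
  ac_stieltjes c l' <= ac_stieltjes c l.
Proof.
move=> dl ll'; have dl' : d c < l' by exact: lt_le_trans ll'.
rewrite -lee_fin -!ac_stieltjesE//; apply: ge0_le_integral => //.
- by move=> x _; rewrite lee_fin ac_integrand_ge0.
- by apply/measurable_EFinP; exact: measurable_ac_integrand.
- by apply/measurable_EFinP; exact: measurable_ac_integrand.
move=> x _; rewrite lee_fin.
have [xd|xd] := boolP (`|x| <= d c); last by rewrite /phi (negbTE xd) !mul0r.
have xd' : x <= d c by exact: le_trans (ler_norm x) xd.
rewrite ler_wpM2l ?phi_ge0// lef_pV2 ?posrE ?subr_gt0 ?lerD2r//.
  exact: le_lt_trans dl'.
exact: le_lt_trans dl.
Qed.

(** On the support l' - x >= l - d, so 1 / (l - x) - 1 / (l' - x) is at most (l' - l) / (l - d)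
    times 1 / (l - x); the integral of the latter against phi is at most 1 / c by
    [neg_stieltjes_lt1]. *)
Lemma ac_stieltjes_lipschitz l l' : d c < l -> l <= l' ->
  ac_stieltjes c l - ac_stieltjes c l' <= (l' - l) / (l - d c) / c.
Proof.
move=> dl ll'; have dl' : d c < l' by exact: lt_le_trans ll'.
have q0 : 0 <= (l' - l) / (l - d c) by rewrite divr_ge0// subr_ge0// ltW.
(* The additive form keeps all integrands nonnegative. *)
have h : ac_stieltjes c l <= ac_stieltjes c l' + (l' - l) / (l - d c) * ac_stieltjes c l.
  rewrite -lee_fin EFinD EFinM -!ac_stieltjesE//.
  rewrite -ge0_integralZl_EFin//; last 2 first.
  - by move=> x _; rewrite lee_fin ac_integrand_ge0.
  - by apply/measurable_EFinP; exact: measurable_ac_integrand.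
  rewrite -ge0_integralD//; last 4 first.
  - by move=> x _; rewrite lee_fin ac_integrand_ge0.
  - by apply/measurable_EFinP; exact: measurable_ac_integrand.
  - by move=> x _; rewrite -EFinM lee_fin mulr_ge0// ac_integrand_ge0.
  - apply/measurable_EFinP; apply: measurable_funM => //.
    exact: measurable_ac_integrand.
  apply: ge0_le_integral => //.
  - by move=> x _; rewrite lee_fin ac_integrand_ge0.
  - by apply/measurable_EFinP; exact: measurable_ac_integrand.
  - apply/measurable_EFinP; apply: measurable_funD.
      exact: measurable_ac_integrand.
    by apply: measurable_funM => //; exact: measurable_ac_integrand.
  move=> x _; rewrite -EFinM -EFinD lee_fin.
  have [xd|xd] := boolP (`|x| <= d c); last by rewrite /phi (negbTE xd) !mul0r mulr0 addr0.
  have xd' : x <= d c by exact: le_trans (ler_norm x) xd.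
  have lx : 0 < l - x by rewrite subr_gt0 (le_lt_trans xd').
  have lx' : 0 < l' - x by rewrite subr_gt0 (le_lt_trans xd').
  rewrite [X in _ <= _ + X]mulrCA -mulrDr ler_wpM2l ?phi_ge0//.
  rewrite -lerBlDl (_ : _ - _ = (l' - l) / (l' - x) / (l - x)); last first.
    by field; rewrite !gt_eqF.
  rewrite ler_wpM2r ?invr_ge0 ?(ltW lx)// ler_wpM2l ?subr_ge0//.
  by rewrite lef_pV2 ?posrE ?lerB// subr_gt0.
have : (l' - l) / (l - d c) * ac_stieltjes c l <= (l' - l) / (l - d c) / c.
  rewrite ler_wpM2l//; have := neg_stieltjes_lt1 dl.
  have : 0 <= c * (atom / l).
    by rewrite mulr_ge0 ?(ltW c0)// divr_ge0 ?atom_ge0// ltW// (lt_trans (d_gt0 c0)).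
  rewrite /neg_stieltjes mulrDr => H1 H2.
  by rewrite -(@ler_pM2l _ c)// mulfV ?gt_eqF//; lra.
by lra.
Qed.

Lemma neg_stieltjes_nonincreasing l l' : d c < l -> l <= l' ->
  neg_stieltjes l' <= neg_stieltjes l.
Proof.
move=> dl ll'; have l0 : 0 < l by rewrite (lt_trans (d_gt0 c0)).
rewrite lerD ?ac_stieltjes_nonincreasing// ler_wpM2l ?atom_ge0//.
by rewrite lef_pV2// posrE (lt_le_trans l0).
Qed.

Lemma continuous_neg_stieltjes l : d c < l -> {for l, continuous neg_stieltjes}.
Proof.
move=> dl; have l0 : 0 < l by rewrite (lt_trans (d_gt0 c0)).
apply: cvgD; last first.
  by apply: cvgM; [exact: cvg_cst|apply: inv_continuous; rewrite gt_eqF].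
(* To the right of m the Lipschitz constant is at most 1 / ((m - d) c), uniformly near l. *)
pose m := (l + d c) / 2.
have dm : d c < m by rewrite /m; lra.
have ml : m < l by rewrite /m; lra.
have md : 0 < m - d c by rewrite subr_gt0.
apply/cvgrPdist_le => e e0; near=> z.
have mz : m < z by near: z; exact: lt_nbhsr.
have dz : d c < z by exact: lt_trans mz.
have zl : `|l - z| <= e * (m - d c) * c.
  near: z; apply: cvgr_dist_le; first exact: cvg_id.
  by rewrite !mulr_gt0.
have key u v : m < u -> u <= v -> v - u <= e * (m - d c) * c ->
    `|ac_stieltjes c u - ac_stieltjes c v| <= e.
  move=> mu_ uv vu; have du : d c < u by exact: lt_trans mu_.
  rewrite ger0_norm ?subr_ge0 ?ac_stieltjes_nonincreasing//.
  apply: (le_trans (ac_stieltjes_lipschitz du uv)).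
  rewrite ler_pdivrMr// ler_pdivrMr ?subr_gt0//.
  rewrite (le_trans vu)// mulrAC ler_wpM2l ?mulr_ge0 ?ltW//.
  by rewrite ltrD2r.
have [lz|lz] := leP l z.
  by apply: key => //; move: zl; rewrite distrC ger0_norm// subr_ge0.
rewrite distrC; apply: key => //; first exact: ltW.
by move: zl; rewrite ger0_norm// subr_ge0 ltW.
Unshelve. all: by end_near. Qed.

Lemma measurable_stieltjes_integrand l : measurable_fun [set: R] (fun x => (x - l)^-1).
Proof. by apply: (measurableT_comp (@measurable_invr R)); exact: measurable_funB. Qed.

Lemma stieltjes_right l : d c < l -> stieltjes c0 l = - neg_stieltjes l.
Proof.
move=> dl; have dg := d_gt0 c0.
have mi := measurable_stieltjes_integrand l.
have pos x : D x -> 0 <= - (x - l)^-1.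
  rewrite /= in_itv/= => /andP[_ xd]; rewrite -invrN invr_ge0 opprB subr_ge0.
  by rewrite (le_trans xd)// ltW.
rewrite /stieltjes /Rintegral integral_FcE; last exact/measurable_EFinP.
(* The integrand is negative on the support, whereas [ge0_integral_Fc] is about nonnegative ones. *)
transitivity (fine (- \int[Fc c0]_(x in D) (- (x - l)^-1)%:E)%E).
  rewrite -integral_ge0N; last by move=> x /pos; rewrite lee_fin.
  by congr fine; apply: eq_integral => x _; rewrite EFinN oppeK.
rewrite ge0_integral_Fc//; last exact: measurableT_comp.
rewrite /neg_stieltjes [X in (X + _)%E](_ : _ = (ac_stieltjes c l)%:E); last first.
  rewrite -ac_stieltjesE//; apply: eq_integral => x _.
  by rewrite -invrN opprB.
by rewrite sub0r invrN opprK.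
Qed.

Lemma stieltjes_left l : l < - d c -> stieltjes c0 l = neg_stieltjes (- l).
Proof.
move=> ld; have dg := d_gt0 c0; have dl : d c < - l by lra.
have mi := measurable_stieltjes_integrand l.
have pos x : D x -> 0 <= (x - l)^-1.
  rewrite /= in_itv/= => /andP[xd _]; rewrite invr_ge0 subr_ge0.
  by rewrite (le_trans _ xd)// ltW.
rewrite /stieltjes /Rintegral integral_FcE; last exact/measurable_EFinP.
rewrite ge0_integral_Fc//.
rewrite /neg_stieltjes [X in (X + _)%E](_ : _ = (ac_stieltjes c (- l))%:E); last first.
  rewrite -ac_stieltjesE// -[RHS]ge0_integral_lebesgueN.
  - by apply: eq_integral => x _; rewrite ac_integrandN addrC.
  - by apply/measurable_EFinP; exact: measurable_ac_integrand.
  - by move=> x; rewrite lee_fin ac_integrand_ge0.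
by rewrite sub0r.
Qed.

Lemma stieltjes_odd l : d c < l -> stieltjes c0 (- l) = - stieltjes c0 l.
Proof.
by move=> dl; rewrite stieltjes_left ?ltrN2// stieltjes_right// !opprK.
Qed.

End neg_stieltjes.

(** * Solutions of g(l) = a *)

Section odd_increasing.
Context {R : realType}.
Variables (G : R -> R) (D : R).
Hypotheses (G_incr : forall x y, D < x -> x < y -> G x < G y)
  (G_odd : forall x, D < x -> G (- x) = - G x)
  (G_cont : forall x, D < x -> {for x, continuous G})
  (G_lb : exists M, forall x, D < x -> M <= G x)
  (G_ub : forall a, exists2 x, D < x & a <= G x).

(** By monotonicity this infimum is the right limit of G at D; it is finite by [G_lb]. *)
Let L := inf (G @` `]D, +oo[).

Let has_infG : has_inf (G @` `]D, +oo[).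
Proof.
split; first by exists (G (D + 1)), (D + 1) => //=; rewrite in_itv/= andbT ltrDl.
have [M GM] := G_lb; exists M => _ [x /= xD <-]; apply: GM.
by rewrite in_itv/= andbT in xD.
Qed.

Let G_gtL x : D < x -> L < G x.
Proof.
move=> Dx; pose m := (D + x) / 2.
have Dm : D < m by rewrite /m; lra.
have mx : m < x by rewrite /m; lra.
apply: le_lt_trans (G_incr Dm mx); apply: ge_inf; first exact: has_infG.2.
by exists m => //=; rewrite in_itv/= andbT.
Qed.

Let G_near a : L < a -> exists2 x, D < x & G x < a.
Proof.
move=> La; have e0 : 0 < a - L by rewrite subr_gt0.
have [_ [x /= xD <-] xa] := inf_adherent e0 has_infG.
exists x; first by rewrite in_itv/= andbT in xD.
by move: xa; rewrite -/L; lra.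
Qed.

Let G_inj x y : D < x -> D < y -> G x = G y -> x = y.
Proof.
move=> Dx Dy xy; have [h|h|//] := ltgtP x y.
  by have := G_incr Dx h; rewrite xy ltxx.
by have := G_incr Dy h; rewrite xy ltxx.
Qed.

Let G_surj a : L < a -> exists2 x, D < x & G x = a.
Proof.
move=> La; have [x Dx xa] := G_near La; have [y Dy ay] := G_ub a.
have xy : x <= y.
  rewrite leNgt; apply/negP => yx.
  by have := G_incr Dy yx; rewrite ltNge (le_trans (ltW xa) ay).
have I z : x <= z -> D < z by exact: lt_le_trans.
have [||z] := @IVT _ G x y a xy.
- apply: continuous_in_subspaceT => z; rewrite inE/= in_itv/= => /andP[xz _].
  exact/G_cont/I.
- by rewrite ge_min le_max (ltW xa) ay orbT.
by rewrite in_itv/= => /andP[xz _] Gz; exists z => //; exact: I.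
Qed.

Lemma odd_increasing_cvg : G x @[x --> D^'+] --> L.
Proof.
apply: (@nondecreasing_at_right_cvgr _ G D (BInfty _ false)) => //.
- move=> x y; rewrite !in_itv/= !andbT => Dx _.
  by rewrite le_eqVlt => /predU1P[->//|xy]; rewrite ltW// G_incr.
- exact: has_infG.2.
Qed.

Lemma odd_increasing_cvgN : G x @[x --> (- D)^'-] --> - L.
Proof.
apply/cvg_at_leftNP; rewrite opprK.
apply: cvg_trans (cvgN odd_increasing_cvg).
apply: near_eq_cvg; near=> x; rewrite /= G_odd//.
Unshelve. all: by end_near. Qed.

(** On the right, G maps ]D, +oo[ bijectively onto ]L, +oo[, as the infimum L is not attained. By
    oddness the left half-line is mapped bijectively onto ]-oo, - L[, and each case compares a with
    L and - L. *)
Lemma odd_increasing_solutions a :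
  let gd := lim (G l @[l --> D^'+]) in
  let right := `]D, +oo[%classic in
  let left := `]-oo, - D[%classic in
  let one_solution_in (I : set R) := exists! l, I l /\ G l = a in
  let no_solution_in (I : set R) := forall l, I l -> G l <> a in
  G l @[l --> D^'+] --> gd /\
  G l @[l --> (- D)^'-] --> - gd /\
  (forall x y, right x -> right y -> x < y -> G x < G y) /\
  (forall x y, left x -> left y -> x < y -> G x < G y) /\
  (0 <= gd ->
     (gd < a -> one_solution_in right /\ no_solution_in left) /\
     (- gd <= a <= gd -> no_solution_in (right `|` left)) /\
     (a < - gd -> one_solution_in left /\ no_solution_in right)) /\
  (gd < 0 ->
     (- gd <= a -> one_solution_in right /\ no_solution_in left) /\
     (gd < a < - gd -> one_solution_in right /\ one_solution_in left) /\
     (a <= gd -> one_solution_in left /\ no_solution_in right)).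
Proof.
move=> gd right left one no.
have gdE : gd = L by apply/cvg_lim => //; exact: odd_increasing_cvg.
have rightP x : right x <-> D < x by rewrite /right/= in_itv/= andbT.
have leftP x : left x <-> D < - x by rewrite /left/= in_itv/= ltrNr.
have GN x : left x -> G x = - G (- x) by move=> /leftP Dx; rewrite -G_odd// opprK.
have one_right : gd < a -> one right.
  rewrite gdE => /G_surj[x Dx Gx]; exists x; split; first by split; [exact/rightP|].
  by move=> y [/rightP Dy Gy]; apply: G_inj => //; rewrite Gx Gy.
have no_right : a <= gd -> no right.
  rewrite gdE => aL x /rightP/G_gtL Lx Gx.
  by move: Lx; rewrite Gx ltNge aL.
have one_left : a < - gd -> one left.
  rewrite gdE ltrNr => /G_surj[x Dx Gx]; exists (- x).
  have lx : left (- x) by apply/leftP; rewrite opprK.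
  split; first by split=> //; rewrite GN// opprK Gx opprK.
  move=> y [ly Gy]; have /leftP Dy := ly.
  by rewrite -[y]opprK; congr (- _); apply: G_inj => //; rewrite Gx -Gy GN// opprK.
have no_left : - gd <= a -> no left.
  rewrite gdE => aL x lx Gx; have /leftP/G_gtL := lx.
  by rewrite ltNge => /negP; apply; rewrite lerNl in aL; rewrite -[G _]opprK -GN// Gx.
split; first by rewrite gdE; exact: odd_increasing_cvg.
split; first by rewrite gdE; exact: odd_increasing_cvgN.
split; first by move=> x y /rightP Dx _; exact: G_incr.
split.
  move=> x y lx ly xy; rewrite (GN x)// (GN y)// ltrN2; apply: G_incr; first exact/leftP.
  by rewrite ltrN2.
split=> gd0; split.
- by move=> ga; split; [exact: one_right|apply: no_left; lra].
- split; first by move=> /andP[h1 h2] x [|]; [exact: no_right|exact: no_left].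
  by move=> ag; split; [exact: one_left|apply: no_right; lra].
- by move=> ga; split; [apply: one_right; lra|exact: no_left].
- split; first by move=> /andP[h1 h2]; split; [exact: one_right|exact: one_left].
  by move=> ag; split; [apply: one_left; lra|exact: no_right].
Qed.

End odd_increasing.

Lemma ler_div_add2 (R : realFieldType) (p q : R) : 0 < p -> p <= q ->
  p / (p + 2) <= q / (q + 2).
Proof.
move=> p0 pq; have q0 : 0 < q by exact: lt_le_trans pq.
by rewrite ler_pdivrMr ?addr_gt0// mulrAC ler_pdivlMr ?addr_gt0//; nra.
Qed.

(** * Monotonicity, continuity and growth of [g] *)

Section g_properties.
Context {R : realType}.
Variables (c lambda : R) (c0 : 0 < c) (lambda0 : 0 < lambda).
Implicit Types l : R.

Local Notation v l := (c * neg_stieltjes c l).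
Definition g_weight l : R := 1 - v l ^+ 2 + Num.sqrt (1 - v l ^+ 2).

Let v_ge0 l : d c < l -> 0 <= v l.
Proof. by move=> dl; rewrite mulr_ge0 ?neg_stieltjes_ge0// ltW. Qed.

Let vv_lt1 l : d c < l -> 0 < 1 - v l ^+ 2.
Proof.
by move=> dl; rewrite subr_gt0 exprn_ilt1 ?v_ge0 ?neg_stieltjes_lt1.
Qed.

Lemma g_weight_gt0 l : d c < l -> 0 < g_weight l.
Proof. by move=> dl; rewrite addr_gt0 ?sqrtr_gt0 ?vv_lt1. Qed.

Lemma g_weight2_gt0 l : d c < l -> 0 < g_weight l + 2.
Proof. by move=> dl; apply: addr_gt0 => //; exact: g_weight_gt0. Qed.

Lemma g_weight_nondecreasing l l' : d c < l -> l <= l' -> g_weight l <= g_weight l'.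
Proof.
move=> dl ll'; have dl' := lt_le_trans dl ll'.
have vv : 1 - v l ^+ 2 <= 1 - v l' ^+ 2.
  rewrite lerD2l lerN2 lerXn2r ?nnegrE ?v_ge0// ler_wpM2l ?(ltW c0)//.
  exact: neg_stieltjes_nonincreasing.
by rewrite lerD// ler_wsqrtr.
Qed.

Lemma g_rightE l : d c < l -> g c0 lambda l =
  2 * (1 + 1 / lambda) * (- (v l / (g_weight l + 2)))
  + 2 / lambda * (l * (g_weight l / (g_weight l + 2))).
Proof.
move=> dl; have w0 := g_weight_gt0 dl.
have w2 := g_weight2_gt0 dl.
rewrite /g stieltjes_right// sqrrN -exprMn -/(g_weight l).
by field; rewrite !gt_eqF.
Qed.

Lemma g_increasing l l' : d c < l -> l < l' -> g c0 lambda l < g c0 lambda l'.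
Proof.
move=> dl ll'; have dl' := lt_trans dl ll'.
have w0 := g_weight_gt0 dl; have w0' := g_weight_gt0 dl'.
have ww := g_weight_nondecreasing dl (ltW ll').
have vv : v l' <= v l.
  by rewrite ler_wpM2l ?(ltW c0)// neg_stieltjes_nonincreasing// ltW.
have v0 := v_ge0 dl'.
(* The first summand is nondecreasing; strictness comes from the factor l of the second. *)
rewrite !g_rightE//; apply: ler_ltD.
  rewrite ler_wpM2l ?mulr_ge0 ?addr_ge0 ?divr_ge0 ?(ltW lambda0)// lerN2.
  apply: ler_pM => //; first by rewrite invr_ge0 ltW// g_weight2_gt0.
  by rewrite lef_pV2 ?posrE ?g_weight2_gt0// lerD2r.
rewrite ltr_pM2l ?divr_gt0//.
have wq : g_weight l / (g_weight l + 2) <= g_weight l' / (g_weight l' + 2).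
  exact: ler_div_add2.
apply: (@lt_le_trans _ _ (l' * (g_weight l / (g_weight l + 2)))).
  by rewrite ltr_pM2r// divr_gt0// g_weight2_gt0.
by rewrite ler_wpM2l// ltW// (lt_trans (d_gt0 c0)).
Qed.

Lemma g_odd l : d c < l -> g c0 lambda (- l) = - g c0 lambda l.
Proof.
move=> dl; rewrite /g stieltjes_odd// !sqrrN.
by rewrite -[RHS]mulrN; congr (_ * _); rewrite !mulrN !mulNr -opprD.
Qed.

Lemma continuous_g l : d c < l -> {for l, continuous (g c0 lambda)}.
Proof.
move=> dl.
pose h z := 2 * (1 + 1 / lambda) * (- (v z / (g_weight z + 2)))
  + 2 / lambda * (z * (g_weight z / (g_weight z + 2))).
have hg : \forall z \near l, h z = g c0 lambda z.
  near=> z; rewrite g_rightE//; near: z; exact: lt_nbhsr.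
have cv : v z @[z --> l] --> v l.
  by apply: cvgM; [exact: cvg_cst|exact: continuous_neg_stieltjes].
have cvv : 1 - v z ^+ 2 @[z --> l] --> 1 - v l ^+ 2.
  by apply: cvgB; [exact: cvg_cst|exact: cvg_sqr].
have cw : g_weight z @[z --> l] --> g_weight l.
  by apply: cvgD => //; apply: continuous_cvg => //; exact: sqrt_continuous.
have cw2 : (g_weight z + 2)^-1 @[z --> l] --> (g_weight l + 2)^-1.
  apply: cvgV; first by rewrite gt_eqF// g_weight2_gt0.
  by apply: cvgD => //; exact: cvg_cst.
have ch : h z @[z --> l] --> h l.
  apply: cvgD.
    by apply: cvgM; [exact: cvg_cst|apply: cvgN; exact: cvgM].
  apply: cvgM; first exact: cvg_cst.
  by apply: cvgM; [exact: cvg_id|exact: cvgM].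
suff : g c0 lambda z @[z --> l] --> g c0 lambda l by [].
have -> : g c0 lambda l = h l by rewrite g_rightE.
by apply: cvg_trans ch; exact: near_eq_cvg.
Unshelve. all: by end_near. Qed.

(** In [g_rightE] the second summand is nonnegative, and v / (q + 2) <= 1 / 2 because v < 1 and q >
    0. *)
Lemma g_lower_bound l : d c < l -> - (1 + 1 / lambda) <= g c0 lambda l.
Proof.
move=> dl; have w0 := g_weight_gt0 dl; rewrite g_rightE//.
have l0 : 0 < l by exact: lt_trans (d_gt0 c0) dl.
have B : 0 <= 2 / lambda * (l * (g_weight l / (g_weight l + 2))).
  apply: mulr_ge0; first by rewrite divr_ge0// ltW.
  apply: mulr_ge0; first exact: ltW.
  by apply: divr_ge0; [exact: ltW|rewrite ltW// g_weight2_gt0].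
have A : v l / (g_weight l + 2) <= 1 / 2.
  apply: ler_pM; first exact: v_ge0.
  - by rewrite invr_ge0 ltW// g_weight2_gt0.
  - by rewrite ltW// neg_stieltjes_lt1.
  by rewrite lef_pV2 ?posrE ?g_weight2_gt0// lerDr ltW.
have L0 : 0 <= 1 + 1 / lambda by rewrite addr_ge0 ?divr_ge0 ?(ltW lambda0).
have := ler_wpM2l L0 A; lra.
Qed.

Lemma g_unbounded a : exists2 l, d c < l & a <= g c0 lambda l.
Proof.
pose m := d c + 1.
have dm : d c < m by rewrite ltrDl.
have wm := g_weight_gt0 dm; pose e := 2 / lambda * (g_weight m / (g_weight m + 2)).
have e0 : 0 < e by rewrite mulr_gt0 ?divr_gt0// g_weight2_gt0.
(* For l >= m the second summand of [g_rightE] is at least l e, the weight being nondecreasing, and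
   the first is at least - (1 + 1 / lambda). *)
pose l := Num.max m ((a + (1 + 1 / lambda)) / e).
have ml : m <= l by rewrite le_max lexx.
have dl : d c < l by exact: lt_le_trans ml.
exists l => //; have wl := g_weight_gt0 dl.
have l0 : 0 < l by exact: lt_trans (d_gt0 c0) dl.
have ww := g_weight_nondecreasing dm ml.
have le_ : a + (1 + 1 / lambda) <= l * e by rewrite -ler_pdivrMr// le_max lexx orbT.
rewrite g_rightE//.
have wq : g_weight m / (g_weight m + 2) <= g_weight l / (g_weight l + 2).
  exact: ler_div_add2.
have B : l * e <= 2 / lambda * (l * (g_weight l / (g_weight l + 2))).
  rewrite /e mulrCA ler_wpM2l ?divr_ge0 ?(ltW lambda0)//.
  by rewrite ler_wpM2l// ltW.
have A : v l / (g_weight l + 2) <= 1 / 2.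
  apply: ler_pM; first exact: v_ge0.
  - by rewrite invr_ge0 ltW// g_weight2_gt0.
  - by rewrite ltW// neg_stieltjes_lt1.
  by rewrite lef_pV2 ?posrE ?g_weight2_gt0// lerDr ltW.
have L0 : 0 <= 1 + 1 / lambda by rewrite addr_ge0 ?divr_ge0 ?(ltW lambda0).
have := ler_wpM2l L0 A; lra.
Qed.

End g_properties.

Theorem mainTheorem2 (R : realType) (c lambda a : R)
    (c_gt0 : 0 < c) (lambda_gt0 : 0 < lambda) :
  let G := g c_gt0 lambda in
  let D := d c in
  let gd := lim (G l @[l --> D^'+]) in
  let right := `]D, +oo[%classic in
  let left := `]-oo, - D[%classic in
  let one_solution_in (I : set R) := exists! l, I l /\ G l = a in
  let no_solution_in (I : set R) := forall l, I l -> G l <> a in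
  G l @[l --> D^'+] --> gd /\
  G l @[l --> (- D)^'-] --> - gd /\
  (forall x y, right x -> right y -> x < y -> G x < G y) /\
  (forall x y, left x -> left y -> x < y -> G x < G y) /\
  (0 <= gd ->
     (gd < a -> one_solution_in right /\ no_solution_in left) /\
     (- gd <= a <= gd -> no_solution_in (right `|` left)) /\
     (a < - gd -> one_solution_in left /\ no_solution_in right)) /\
  (gd < 0 ->
     (- gd <= a -> one_solution_in right /\ no_solution_in left) /\
     (gd < a < - gd -> one_solution_in right /\ one_solution_in left) /\
     (a <= gd -> one_solution_in left /\ no_solution_in right)).
Proof.
apply: odd_increasing_solutions.
- by move=> x y; exact: g_increasing.
- by move=> x; exact: g_odd.
- by move=> x; exact: continuous_g.
- by exists (- (1 + 1 / lambda)) => x; exact: g_lower_bound.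
- by move=> b; exact: g_unbounded.
Qed.
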